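(* In the sense of analytic continuation (regularization), $$\int_{0}^{\infty}\left(3-2\sqrt2\cos(v\ln 2)\right)\operatorname{Re}\!\left(\zeta\!\left(\tfrac12+iv\right)\right)dv=0;$$ that is, $$\lim_{r\to1,\ r\neq1}\ \lim_{\phi\to\pi^{-}}\int_{0}^{\infty}\left(3-2\sqrt2\cos(v\ln 2)\right)\operatorname{Re}\!\left(r^{iv}\,\zeta\!\left(\tfrac12+iv\right)\right)\frac{\cosh(\phi v)}{\cosh(\pi v)}\,dv=0.$$
   Context: $\zeta$ is the Riemann zeta function; $r>0$ and $\phi$ are real. The undamped integral is not claimed to converge. It is assigned a value by continuation of the damped integrals, which converge for $|\phi|<\pi$. Where the value at $(r,\phi)=(1,\pi)$ depends on the order of limits, the convention is that $\phi\to\pi$ is taken first (at $r\ne1$), followed by $r\to1$ along the real axis. *)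

(* Defs.v *)
From Stdlib Require Import Reals.
From Coquelicot Require Import Coquelicot.
Open Scope R_scope.

Definition Cexp (z : C) : C := (exp (Re z) * cos (Im z), exp (Re z) * sin (Im z)).

(* [x ^ s] for a positive real base, with the real logarithm of [x]. *)
Definition Rcpow (x : R) (s : C) : C := Cexp (s * RtoC (ln x))%C.

Definition analytic_at (f : C -> C) (s : C) : Prop :=
  exists (a : nat -> C) (delta : R), 0 < delta /\
    forall h : C, Cmod h < delta ->
      @is_pseries C_AbsRing C_NormedModule a h (f (s + h)%C).

(* [zeta] is the analytic continuation to C \ {1} of the Dirichlet series; by the
   identity theorem this determines [zeta] away from [1] (its value at [1] is
   unconstrained and plays no role on the critical line). *)
Definition is_riemann_zeta (zeta : C -> C) : Prop :=
  (forall s : C, 1 < Re s ->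
     @is_series C_AbsRing C_NormedModule
       (fun n : nat => Rcpow (INR (S n)) (- s)%C) (zeta s)) /\
  (forall s : C, s <> RtoC 1 -> analytic_at zeta s).

Definition damped_integrand (zeta : C -> C) (r phi v : R) : R :=
  (3 - 2 * sqrt 2 * cos (v * ln 2))
  * Re (Rcpow r (Ci * RtoC v) * zeta (RtoC (1 / 2) + Ci * RtoC v))%C
  * (cosh (phi * v) / cosh (PI * v)).

Definition damped_integral_converges (zeta : C -> C) (r phi : R) : Prop :=
  ex_RInt_gen (damped_integrand zeta r phi) (at_point 0) (Rbar_locally p_infty).

Definition damped_integral (zeta : C -> C) (r phi : R) : R :=
  RInt_gen (damped_integrand zeta r phi) (at_point 0) (Rbar_locally p_infty).

(* Main.v *)
Require Import Defs.
From Stdlib Require Import Reals.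
From Coquelicot Require Import Coquelicot.
From Stdlib Require Import Lra Lia Factorial.
Open Scope R_scope.

(** On the critical line [s = 1/2 + iv] the weight factors as
    [3 - 2 sqrt 2 cos (v ln 2) = (1 - 2^(1-s)) (1 - 2^s)], so the damped integral is
    [J r - sqrt 2 * J (2 r)], where [J rho] is the integral of the damping factor
    [cosh (phi v) / cosh (PI v)] against the real part of [rho^(iv)] times the alternating
    zeta function [(1 - 2^(1-s)) zeta s].

    The alternating series, averaged over consecutive terms, converges absolutely for
    [Re s > 0] and is analytic there, so it agrees with [(1 - 2^(1-s)) zeta s] by the
    identity theorem on a horizontal line. Integrating it term by term gives a series in
    [kernel phi u], the cosine transform of the damping factor, at [u = ln (rho / n)].
    Two integrations by parts show that the kernel is [O (PI - phi)] for [u <> 0], and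
    bounded and Lipschitz for [|u| >= 1], uniformly in [phi]. By dominated convergence of
    the series, [J rho] tends to [0] as [phi] tends to [PI] unless [rho] is a positive
    integer; neither [r] nor [2 r] is one when [r] is close to but distinct from [1]. *)

(** On the critical line the alternating series converges only conditionally, and after averaging
    its remainder still grows linearly in |v|. For fixed [phi] below [PI] the damping absorbs this
    growth, but the resulting error bound degenerates as [phi] tends to [PI]. Uniformity is
    therefore won after integration, on the kernels: a function of the logarithm that is bounded and
    Lipschitz obeys the very estimate that makes the averaged Dirichlet terms summable, so that
    estimate is stated for arbitrary functions of this kind.

    With e = [PI] - [phi] the damping factor equals cosh (e v) - tanh ([PI] v) sinh (e v), which
    tends to 1 pointwise as e tends to 0. Its cosine transform concentrates at u = 0, and this is
    what singles out the positive integers [rho].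

    Complex identities are handled through the real parts of e^(i th) z for all angles th.
    Multiplication by 2^(-iv) then becomes a shift of th, and on a line of fixed v <> 0 both sides
    of the continuation are real-analytic functions of Re s. *)

(** * Real series: comparison, tails, interchange of summations *)

Lemma is_series_Rlim (a : nat -> R) (l : R) :
  is_series a l <-> is_lim_seq (sum_n a) l.
Proof. split; intros H; exact H. Qed.

Lemma sum_n_Rle (a b : nat -> R) (N : nat) :
  (forall n, a n <= b n) -> sum_n a N <= sum_n b N.
Proof.
intros H; induction N as [|N IH].
- rewrite !sum_O; apply H.
- rewrite !sum_Sn; apply Rplus_le_compat; [exact IH | apply H].
Qed.

Lemma is_series_ge_partial (a : nat -> R) (l : R) (N : nat) :
  (forall n, 0 <= a n) -> is_series a l -> sum_n a N <= l.
Proof.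
intros Ha Hl.
assert (H := is_lim_seq_incr_compare (sum_n a) l Hl).
apply H; intros n; rewrite sum_Sn; unfold plus; simpl.
specialize (Ha (S n)); lra.
Qed.

Lemma sum_n_Rabs (a : nat -> R) (N : nat) :
  Rabs (sum_n a N) <= sum_n (fun n => Rabs (a n)) N.
Proof.
induction N as [|N IH].
- rewrite !sum_O; apply Rle_refl.
- rewrite !sum_Sn; unfold plus; simpl.
  eapply Rle_trans; [apply Rabs_triang|]; lra.
Qed.

Lemma ex_series_dominated (a b : nat -> R) :
  (forall n, Rabs (a n) <= b n) -> ex_series b -> ex_series a.
Proof.
intros H Hb; apply (@ex_series_le R_AbsRing R_CompleteNormedModule _ b); assumption.
Qed.

(** Domination is asked only past [N], because for the kernel series it is available only at large
    indices. *)
Lemma Series_tail_le (a M : nat -> R) (N : nat) :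
  (forall n, (N < n)%nat -> Rabs (a n) <= M n) -> ex_series a -> ex_series M ->
  Rabs (Series a - sum_n a N) <= Series M - sum_n M N.
Proof.
intros H Ha HM.
rewrite (Series_incr_n a (S N)), (Series_incr_n M (S N)) by (lia || assumption).
rewrite !sum_n_Reals; simpl pred.
replace (sum_f_R0 a N + Series (fun k => a (S N + k)%nat) - sum_f_R0 a N)
  with (Series (fun k => a (S N + k)%nat)) by ring.
replace (sum_f_R0 M N + Series (fun k => M (S N + k)%nat) - sum_f_R0 M N)
  with (Series (fun k => M (S N + k)%nat)) by ring.
assert (HM' : ex_series (fun k => M (S N + k)%nat)) by (apply (ex_series_incr_n M (S N)); exact HM).
assert (Ha' : ex_series (fun k => Rabs (a (S N + k)%nat))).
{ apply ex_series_dominated with (fun k => M (S N + k)%nat); [|exact HM'].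
  intros n; rewrite Rabs_Rabsolu; apply H; lia. }
eapply Rle_trans; [apply Series_Rabs; exact Ha'|].
apply Series_le; [|exact HM'].
intros n; split; [apply Rabs_pos | apply H; lia].
Qed.

Lemma is_lim_seq_eps (u : nat -> R) (l : R) :
  (forall eps, 0 < eps -> exists N, forall n, (N <= n)%nat -> Rabs (u n - l) <= eps) ->
  is_lim_seq u l.
Proof.
intros H; apply is_lim_seq_spec; intros eps.
destruct (H (eps / 2)) as [N HN]; [destruct eps; simpl; lra|].
exists N; intros n Hn; specialize (HN n Hn); destruct eps; simpl in *; lra.
Qed.

Lemma is_lim_seq_eps_inv (u : nat -> R) (l : R) :
  is_lim_seq u l ->
  forall eps, 0 < eps -> exists N, forall n, (N <= n)%nat -> Rabs (u n - l) < eps.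
Proof.
intros H eps He; apply is_lim_seq_spec in H; exact (H (mkposreal eps He)).
Qed.

Lemma Series_sum_n_swap (a : nat -> nat -> R) (K : nat) :
  (forall k, ex_series (fun n => a n k)) ->
  Series (fun n => sum_n (a n) K) = sum_n (fun k => Series (fun n => a n k)) K /\
  ex_series (fun n => sum_n (a n) K).
Proof.
intros H; induction K as [|K [IH1 IH2]].
- rewrite sum_O; split.
  + apply Series_ext; intros n; apply sum_O.
  + apply ex_series_ext with (2 := H 0%nat); intros n; symmetry; apply sum_O.
- rewrite sum_Sn, <- IH1; split.
  + unfold plus; simpl; rewrite <- Series_plus; [|exact IH2 | apply H].
    apply Series_ext; intros n; rewrite sum_Sn; reflexivity.
  + apply ex_series_ext with (fun n => sum_n (a n) K + a n (S K)).
    * intros n; rewrite sum_Sn; reflexivity.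
    * apply (ex_series_plus (V := R_NormedModule)); [exact IH2 | apply H].
Qed.

(** Fubini for a double series. Past a large [N] the rows contribute little, uniformly in [K], since
    their partial sums and their limits are all bounded by [M]; the finitely many rows up to [N]
    converge one by one. *)
Lemma is_series_swap (a : nat -> nat -> R) (b M : nat -> R) :
  (forall n, is_series (a n) (b n)) ->
  (forall n K, sum_n (fun k => Rabs (a n k)) K <= M n) ->
  ex_series M ->
  is_series (fun k => Series (fun n => a n k)) (Series b).
Proof.
intros Hb HK HM.
assert (Hak : forall k, ex_series (fun n => a n k)).
{ intros k; apply ex_series_dominated with M; [|exact HM].
  intros n; eapply Rle_trans; [|apply (HK n k)].
  destruct k; [rewrite sum_O; apply Rle_refl|].
  rewrite sum_Sn; unfold plus; simpl.
  assert (0 <= sum_n (fun k0 => Rabs (a n k0)) k); [|lra].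
  eapply Rle_trans; [apply Rabs_pos | apply sum_n_Rabs]. }
assert (HbM : forall n, Rabs (b n) <= M n).
{ intros n.
  assert (Hl : is_lim_seq (fun K => Rabs (sum_n (a n) K)) (Rabs (b n)))
    by (apply (is_lim_seq_abs _ (Finite (b n))), Hb).
  apply (is_lim_seq_le _ _ (Rabs (b n)) (M n)) with (2 := Hl) (3 := is_lim_seq_const (M n)).
  intros K; eapply Rle_trans; [apply sum_n_Rabs | apply HK]. }
apply is_series_Rlim, is_lim_seq_eps; intros eps He.
assert (HSM : is_lim_seq (sum_n M) (Series M)) by (apply Series_correct, HM).
destruct (is_lim_seq_eps_inv _ _ HSM (eps / 3) ltac:(lra)) as [N HN].
specialize (HN N (Nat.le_refl N)).
assert (Hsum : is_lim_seq (fun K => sum_n (fun n => sum_n (a n) K) N) (sum_n b N)).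
{ clear HN; induction N as [|N IH].
  - rewrite sum_O; apply is_lim_seq_ext with (sum_n (a 0%nat)); [|apply Hb].
    intros n; rewrite sum_O; reflexivity.
  - rewrite sum_Sn; apply is_lim_seq_ext with (fun K => sum_n (fun n => sum_n (a n) K) N + sum_n (a (S N)) K).
    + intros n; rewrite sum_Sn; reflexivity.
    + apply is_lim_seq_plus'; [exact IH | apply Hb]. }
destruct (is_lim_seq_eps_inv _ _ Hsum (eps / 3) ltac:(lra)) as [K0 HK0].
exists K0; intros K HKK; specialize (HK0 K HKK).
destruct (Series_sum_n_swap a K Hak) as [E1 E2].
rewrite <- E1.
assert (T1 := Series_tail_le (fun n => sum_n (a n) K) M N
  (fun n _ => Rle_trans _ _ _ (sum_n_Rabs (a n) K) (HK n K)) E2 HM).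
assert (T2 := Series_tail_le b M N (fun n _ => HbM n) (ex_series_dominated _ _ HbM HM) HM).
apply Rabs_def2 in HN; apply Rabs_def2 in HK0.
apply Rabs_le_between in T1; apply Rabs_le_between in T2.
apply Rabs_le; lra.
Qed.

(** * Real-analytic functions and the identity theorem *)

Definition real_analytic_at (f : R -> R) (x : R) : Prop :=
  exists (a : nat -> R) (d : R), 0 < d /\
    forall h, Rabs h < d -> is_pseries a h (f (x + h)).

(** Convergence at the midpoint [m] of |h| and [d] puts [m] within the radius, because outside it
    the terms do not tend to 0. The strict inequality is what products of power series require. *)
Lemma CV_radius_gt (a : nat -> R) (f : R -> R) (d h : R) :
  (forall x, Rabs x < d -> is_pseries a x (f x)) -> Rabs h < d ->
  Rbar_lt (Rabs h) (CV_radius a).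
Proof.
intros H Hh.
set (m := (Rabs h + d) / 2).
assert (Hm : Rabs h < m < d) by (unfold m; lra).
apply Rbar_lt_le_trans with (Finite m); [simpl; lra|].
assert (H0 := Rabs_pos h).
destruct (Rbar_le_lt_dec m (CV_radius a)) as [Hle|Hlt]; [exact Hle|exfalso].
apply (CV_disk_outside a m).
- rewrite Rabs_pos_eq by lra; exact Hlt.
- assert (Hs : is_pseries a m (f m)) by (apply H; rewrite Rabs_pos_eq; lra).
  apply is_pseries_R in Hs.
  apply ex_series_lim_0; exists (f m); exact Hs.
Qed.

Lemma real_analytic_ext (f g : R -> R) (x : R) :
  (forall y, f y = g y) -> real_analytic_at f x -> real_analytic_at g x.
Proof.
intros H (a & d & Hd & Ha); exists a, d; split; [exact Hd|].
intros h Hh; rewrite <- H; apply Ha, Hh.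
Qed.

Lemma real_analytic_plus (f g : R -> R) (x : R) :
  real_analytic_at f x -> real_analytic_at g x -> real_analytic_at (fun y => f y + g y) x.
Proof.
intros (a & d & Hd & Ha) (b & e & He & Hb).
exists (PS_plus a b), (Rmin d e); split; [apply Rmin_pos; assumption|].
intros h Hh; apply (is_pseries_plus a b h).
- apply Ha; eapply Rlt_le_trans; [exact Hh | apply Rmin_l].
- apply Hb; eapply Rlt_le_trans; [exact Hh | apply Rmin_r].
Qed.

Lemma real_analytic_mult (f g : R -> R) (x : R) :
  real_analytic_at f x -> real_analytic_at g x -> real_analytic_at (fun y => f y * g y) x.
Proof.
intros (a & d & Hd & Ha) (b & e & He & Hb).
exists (PS_mult a b), (Rmin d e); split; [apply Rmin_pos; assumption|].
intros h Hh.
assert (Hhd : Rabs h < d) by (eapply Rlt_le_trans; [exact Hh | apply Rmin_l]).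
assert (Hhe : Rabs h < e) by (eapply Rlt_le_trans; [exact Hh | apply Rmin_r]).
apply (is_pseries_mult a b h); [apply Ha, Hhd | apply Hb, Hhe | |].
- apply CV_radius_gt with (fun y => f (x + y)) d; assumption.
- apply CV_radius_gt with (fun y => g (x + y)) e; assumption.
Qed.

Lemma is_pseries_const (c h : R) : is_pseries (fun k => match k with O => c | _ => 0 end) h c.
Proof.
apply is_pseries_R, is_series_Rlim.
apply is_lim_seq_ext with (fun _ => c); [|apply is_lim_seq_const].
intros n; induction n as [|n IH].
- rewrite sum_O; simpl; ring.
- rewrite sum_Sn, <- IH; unfold plus; simpl; ring.
Qed.

Lemma real_analytic_const (c x : R) : real_analytic_at (fun _ => c) x.
Proof.
exists (fun k => match k with O => c | _ => 0 end), 1; split; [lra|].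
intros h _; apply is_pseries_const.
Qed.

Lemma real_analytic_scal (c : R) (f : R -> R) (x : R) :
  real_analytic_at f x -> real_analytic_at (fun y => c * f y) x.
Proof. intros H; apply real_analytic_mult; [apply real_analytic_const | exact H]. Qed.

Lemma is_series_exp (x : R) : is_series (fun k => x ^ k / INR (fact k)) (exp x).
Proof.
apply is_series_ext with (2 := proj1 (is_pseries_R _ _ _) (is_exp_Reals x)).
intros n; simpl; unfold Rdiv; ring.
Qed.

Lemma real_analytic_exp (c x : R) : real_analytic_at (fun y => exp (c * y)) x.
Proof.
exists (fun k => exp (c * x) * (c ^ k / INR (fact k))), 1; split; [lra|].
intros h _; apply is_pseries_R.
replace (exp (c * (x + h))) with (exp (c * x) * exp (c * h)) by (rewrite <- exp_plus; f_equal; ring).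
apply is_series_ext with (fun k => scal (exp (c * x)) ((c * h) ^ k / INR (fact k))).
- intros n; unfold scal; simpl; unfold mult; simpl; rewrite Rpow_mult_distr; unfold Rdiv; ring.
- apply (is_series_scal (V := R_NormedModule)), is_series_exp.
Qed.

Lemma CV_radius_decr_n (a : nat -> R) (n : nat) : CV_radius (PS_decr_n a n) = CV_radius a.
Proof.
induction n as [|n IH].
- apply CV_radius_ext; intros k; reflexivity.
- rewrite <- IH, <- (CV_radius_decr_1 (PS_decr_n a n)).
  apply CV_radius_ext; intros k; unfold PS_decr_n, PS_decr_1; f_equal; lia.
Qed.

(** The sum is continuous at 0, so its value there, the constant coefficient, is already determined
    by the values on the right. *)
Lemma pseries_zero_right (a : nat -> R) (d : R) :
  0 < d -> (forall h, 0 < h < d -> PSeries a h = 0) ->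
  Rbar_lt 0 (CV_radius a) -> a O = 0.
Proof.
intros Hd H Hr.
assert (Hc : is_lim (PSeries a) 0 (PSeries a 0)).
{ apply is_lim_continuity, PSeries_continuity; rewrite Rabs_R0; exact Hr. }
rewrite PSeries_0 in Hc.
destruct (Req_dec (a O) 0) as [E|E]; [exact E|exfalso].
apply is_lim_spec in Hc.
assert (He : 0 < Rabs (a O)) by (apply Rabs_pos_lt; exact E).
destruct (Hc (mkposreal _ He)) as [e Hball].
assert (Hp := cond_pos e).
set (h := Rmin (d / 2) (e / 2)).
assert (Hh : 0 < h) by (apply Rmin_pos; lra).
assert (Hh1 : h <= d / 2) by apply Rmin_l.
assert (Hh2 : h <= e / 2) by apply Rmin_r.
specialize (Hball h).
rewrite H in Hball by lra.
simpl in Hball.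
assert (Hb : Rabs (0 - a O) < Rabs (a O)).
{ apply Hball; [|lra].
  unfold ball; simpl; unfold AbsRing_ball, abs, minus, plus, opp; simpl.
  rewrite Rabs_pos_eq; lra. }
replace (0 - a O) with (- a O) in Hb by ring; rewrite Rabs_Ropp in Hb; lra.
Qed.

(** If the coefficients below [n] vanish, f (x + h) is h^n times the series shifted by [n]; the
    latter vanishes for small h > 0, so its constant term [a n] is 0. Once all coefficients are 0,
    the function also vanishes to the left of [x], on the whole disk. *)
Lemma real_analytic_zero_right (f : R -> R) (x : R) :
  real_analytic_at f x -> (forall y, x < y -> f y = 0) ->
  exists d, 0 < d /\ forall y, x - d < y -> f y = 0.
Proof.
intros (a & d & Hd & Ha) Hz.
assert (Hr : forall h, Rabs h < d -> Rbar_lt (Rabs h) (CV_radius a)).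
{ intros h Hh; apply CV_radius_gt with (fun y => f (x + y)) d; assumption. }
assert (Hr0 : Rbar_lt 0 (CV_radius a)).
{ rewrite <- Rabs_R0; apply Hr; rewrite Rabs_R0; exact Hd. }
assert (Hcoef : forall n, (forall k, (k < n)%nat -> a k = 0) -> a n = 0).
{ intros n Hn.
  replace (a n) with (PS_decr_n a n O) by (unfold PS_decr_n; f_equal; lia).
  apply pseries_zero_right with d; [exact Hd | |].
  - intros h Hh.
    assert (Hh' : Rabs h < d) by (rewrite Rabs_pos_eq; lra).
    assert (E := is_pseries_unique _ _ _ (Ha h Hh')).
    rewrite Hz in E by lra.
    destruct n as [|n].
    + rewrite <- E; apply PSeries_ext; intros k; unfold PS_decr_n; f_equal; lia.
    + rewrite (PSeries_decr_n_aux a (S n)) in E by (intros k Hk; apply Hn, Hk).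
      apply Rmult_integral in E; destruct E as [E|E]; [|exact E].
      exfalso; apply (pow_nonzero h (S n)); [lra | exact E].
  - rewrite CV_radius_decr_n; exact Hr0. }
assert (H0 : forall n, a n = 0).
{ intros n; induction n as [n IH] using (well_founded_induction Wf_nat.lt_wf).
  apply Hcoef, IH. }
exists d; split; [exact Hd|].
intros y Hy.
destruct (Rlt_le_dec x y) as [Hl|Hl]; [apply Hz, Hl|].
assert (Hh : Rabs (y - x) < d) by (apply Rabs_def1; lra).
assert (E := is_pseries_unique _ _ _ (Ha _ Hh)).
replace (x + (y - x)) with y in E by ring.
rewrite <- E, (PSeries_ext a (fun _ => 0) _ H0); apply PSeries_const_0.
Qed.

(** Let [m] be the supremum of the points beyond [a] where [f] is nonzero. Vanishing on the right of
    [m] extends a little to the left of [m], which contradicts the choice of [m]. *)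
Lemma real_analytic_identity (f : R -> R) (a b : R) :
  (forall x, a <= x <= b -> real_analytic_at f x) ->
  (forall x, b < x -> f x = 0) ->
  forall x, a <= x -> f x = 0.
Proof.
intros Hf Hb x0 Hx0.
destruct (Req_dec (f x0) 0) as [E|E]; [exact E|exfalso].
set (A := fun x => a <= x /\ f x <> 0).
destruct (completeness A) as [m [Hub Hlub]].
- exists b; intros x [_ Hx]; destruct (Rle_lt_dec x b) as [H|H]; [exact H|].
  exfalso; apply Hx, Hb, H.
- exists x0; split; assumption.
- assert (Hm1 : x0 <= m) by (apply Hub; split; assumption).
  assert (Hm2 : m <= b).
  { apply Hlub; intros x [_ Hx]; destruct (Rle_lt_dec x b) as [H|H]; [exact H|].
    exfalso; apply Hx, Hb, H. }
  destruct (real_analytic_zero_right f m) as (d & Hd & Hz).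
  + apply Hf; lra.
  + intros y Hy; destruct (Req_dec (f y) 0) as [Ey|Ey]; [exact Ey|exfalso].
    assert (y <= m) by (apply Hub; split; [lra | exact Ey]); lra.
  + assert (m <= m - d); [|lra].
    apply Hlub; intros x [_ Hx]; destruct (Rle_lt_dec x (m - d)) as [H|H]; [exact H|].
    exfalso; apply Hx, Hz, H.
Qed.

(** * The averaged alternating series *)

(* Indices start at [0]: [log_nat n], [decay a n] and [dir_term k t n] belong to the integer [n + 1]. *)
Definition log_nat (n : nat) : R := ln (INR (S n)).

Definition decay (a : R) (n : nat) : R := exp (- a * log_nat n).

Definition dir_term (k : R -> R) (t : R) (n : nat) : R := k (log_nat n) * decay t n.

Definition alt_term (k : R -> R) (t : R) (n : nat) : R :=
  (-1) ^ n * (dir_term k t n - dir_term k t (S n)).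

(* [Series (alt_term k t)] is twice the alternating sum minus its first term. *)
Definition eta (k : R -> R) (t : R) : R := (dir_term k t 0 + Series (alt_term k t)) / 2.

(** Two functions of the logarithm are used: [wave th v], with [V] the absolute value of [v], and a
    rescaled and capped kernel, with [V] equal to 1. *)
Definition bounded_lipschitz (k : R -> R) (V : R) : Prop :=
  (forall x, Rabs (k x) <= 1) /\ (forall x y, Rabs (k x - k y) <= V * Rabs (x - y)).

Lemma log_nat_0 : log_nat 0 = 0.
Proof. unfold log_nat; simpl; apply ln_1. Qed.

Lemma exp_le (x y : R) : x <= y -> exp x <= exp y.
Proof. intros [H|H]; [left; apply exp_increasing, H | right; rewrite H; reflexivity]. Qed.

Lemma exp_ge_1_plus (x : R) : 1 + x <= exp x.
Proof.
destruct (Req_dec x 0) as [->|H]; [rewrite exp_0; lra|].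
left; apply exp_ineq1, H.
Qed.

Lemma log_nat_step (n : nat) : 0 <= log_nat (S n) - log_nat n <= 1.
Proof.
unfold log_nat.
assert (H0 : 0 < INR (S n)) by (apply lt_0_INR; lia).
assert (H1 : INR (S (S n)) = INR (S n) + 1) by (rewrite (S_INR (S n)); reflexivity).
assert (H2 : 1 <= INR (S n)) by (change 1 with (INR 1); apply le_INR; lia).
assert (H3 : ln (INR (S n)) <= ln (INR (S (S n)))) by (apply ln_le; lra).
split; [lra|].
assert (ln (INR (S (S n))) <= ln (exp 1 * INR (S n))).
{ apply ln_le; [lra|].
  assert (H4 := exp_ge_1_plus 1); nra. }
rewrite ln_mult, ln_exp in H by (apply exp_pos || lra); lra.
Qed.

Lemma log_nat_nonneg (n : nat) : 0 <= log_nat n.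
Proof.
induction n as [|n IH]; [rewrite log_nat_0; lra|].
assert (H := log_nat_step n); lra.
Qed.

Lemma is_lim_seq_log_nat : is_lim_seq log_nat p_infty.
Proof.
apply (is_lim_comp_seq ln (fun n => INR (S n)) p_infty p_infty).
- apply is_lim_ln_p.
- exists O; intros n _; discriminate.
- apply -> is_lim_seq_incr_1; apply is_lim_seq_INR.
Qed.

Lemma decay_pos (a : R) (n : nat) : 0 < decay a n.
Proof. apply exp_pos. Qed.

Lemma decay_0 (a : R) : decay a 0 = 1.
Proof. unfold decay; rewrite log_nat_0, Rmult_0_r; apply exp_0. Qed.

Lemma is_lim_seq_decay (a : R) : 0 < a -> is_lim_seq (decay a) 0.
Proof.
intros Ha.
apply (is_lim_comp_seq exp (fun n => - a * log_nat n) m_infty 0).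
- apply is_lim_exp_m.
- exists O; intros n _; discriminate.
- replace m_infty with (Rbar_mult (- a) p_infty).
  + apply is_lim_seq_scal_l, is_lim_seq_log_nat.
  + simpl; destruct (Rle_dec 0 (- a)) as [H|H]; [exfalso; lra | reflexivity].
Qed.

Lemma sum_n_telescope (u : nat -> R) (N : nat) :
  sum_n (fun n => u n - u (S n)) N = u 0%nat - u (S N).
Proof.
induction N as [|N IH]; [apply sum_O|].
rewrite sum_Sn, IH; unfold plus; simpl; ring.
Qed.

Lemma is_series_decay_step (a : R) : 0 < a -> is_series (fun n => decay a n - decay a (S n)) 1.
Proof.
intros Ha; apply is_series_Rlim.
apply is_lim_seq_ext with (fun N => 1 - decay a (S N)).
- intros N; rewrite sum_n_telescope, decay_0; reflexivity.
- replace (Finite 1) with (Finite (1 - 0)) by (f_equal; ring).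
  apply is_lim_seq_minus'; [apply is_lim_seq_const|].
  apply -> is_lim_seq_incr_1; apply is_lim_seq_decay, Ha.
Qed.

(** This yields a telescoping majorant whose tails are known exactly. With D the logarithmic step
    and x = e^(a D), the claim reduces to a D x <= (x - 1) e^a, the product of a D <= x - 1 and x <=
    e^a; the latter uses D <= 1. *)
Lemma step_decay_le (a : R) (n : nat) :
  0 < a ->
  (log_nat (S n) - log_nat n) * decay a n <= exp a / a * (decay a n - decay a (S n)).
Proof.
intros Ha; unfold decay.
assert (Hs := log_nat_step n).
set (d := log_nat (S n) - log_nat n) in *.
replace (log_nat (S n)) with (log_nat n + d) by (unfold d; ring).
replace (exp (- a * (log_nat n + d))) with (exp (- a * log_nat n) * exp (- (a * d)))
  by (rewrite <- exp_plus; f_equal; ring).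
assert (H1 := exp_ge_1_plus (a * d)).
assert (H2 : exp (a * d) <= exp a) by (apply exp_le; nra).
assert (H3 := exp_pos (- a * log_nat n)).
rewrite (exp_Ropp (a * d)).
set (x := exp (a * d)) in *.
assert (Hx : 1 <= x) by nra.
replace (exp a / a * (exp (- a * log_nat n) - exp (- a * log_nat n) * / x))
  with (exp (- a * log_nat n) * (exp a * (x - 1) / (a * x))) by (field; lra).
rewrite Rmult_comm; apply Rmult_le_compat_l; [lra|].
apply Rle_div_r; [nra|].
assert (a * d * x <= (x - 1) * exp a); [|nra].
apply Rmult_le_compat; nra.
Qed.

Lemma decay_decr (a : R) (n : nat) : 0 <= a -> decay a (S n) <= decay a n.
Proof. intros Ha; apply exp_le; assert (H := log_nat_step n); nra. Qed.

Lemma decay_diff_le (t : R) (n : nat) :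
  decay t n - decay t (S n) <= t * (log_nat (S n) - log_nat n) * decay t n.
Proof.
unfold decay.
replace (exp (- t * log_nat (S n)))
  with (exp (- t * log_nat n) * exp (- t * (log_nat (S n) - log_nat n)))
  by (rewrite <- exp_plus; f_equal; ring).
assert (H1 := exp_ge_1_plus (- t * (log_nat (S n) - log_nat n))).
assert (H3 := exp_pos (- t * log_nat n)); nra.
Qed.

(** Discrete product rule: [decay] contributes the factor t and [k] the factor V. The logarithmic
    step, of order 1/n, is what the averaging gains over the size of a single term. *)
Lemma dir_term_step (k : R -> R) (V t : R) (n : nat) :
  bounded_lipschitz k V -> 0 <= t ->
  Rabs (dir_term k t n - dir_term k t (S n))
  <= (t + V) * ((log_nat (S n) - log_nat n) * decay t n).
Proof.
intros [Hk1 Hk2] Ht; unfold dir_term.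
replace (k (log_nat n) * decay t n - k (log_nat (S n)) * decay t (S n))
  with (k (log_nat n) * (decay t n - decay t (S n))
        + (k (log_nat n) - k (log_nat (S n))) * decay t (S n)) by ring.
eapply Rle_trans; [apply Rabs_triang|]; rewrite !Rabs_mult.
assert (Hd := decay_decr t n Ht); assert (Hp := decay_pos t (S n)).
assert (Hs := log_nat_step n); assert (Hdd := decay_diff_le t n).
rewrite (Rabs_pos_eq (decay t n - _)), (Rabs_pos_eq (decay t (S n))) by lra.
assert (H1 := Hk1 (log_nat n)); assert (H2 := Hk2 (log_nat n) (log_nat (S n))).
rewrite Rabs_minus_sym, (Rabs_minus_sym (log_nat n)), (Rabs_pos_eq (log_nat (S n) - _)) in H2 by lra.
rewrite Rabs_minus_sym.
set (D := log_nat (S n) - log_nat n) in *.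
assert (H3 := Rabs_pos (k (log_nat n))); assert (H4 := Rabs_pos (k (log_nat (S n)) - k (log_nat n))).
assert (A1 : Rabs (k (log_nat n)) * (decay t n - decay t (S n)) <= 1 * (t * D * decay t n))
  by (apply Rmult_le_compat; lra).
assert (A2 : Rabs (k (log_nat (S n)) - k (log_nat n)) * decay t (S n) <= V * D * decay t n)
  by (apply Rmult_le_compat; lra).
lra.
Qed.

Lemma lipschitz_nonneg (k : R -> R) (V : R) : bounded_lipschitz k V -> 0 <= V.
Proof.
intros [_ H]; specialize (H 1 0); rewrite Rminus_0_r, Rabs_R1 in H.
assert (H0 := Rabs_pos (k 1 - k 0)); lra.
Qed.

Lemma alt_term_bound (k : R -> R) (V t : R) (n : nat) :
  bounded_lipschitz k V -> 0 < t ->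
  Rabs (alt_term k t n) <= (t + V) * (exp t / t) * (decay t n - decay t (S n)).
Proof.
intros Hk Ht; unfold alt_term; rewrite Rabs_mult, pow_1_abs, Rmult_1_l.
eapply Rle_trans; [apply (dir_term_step k V); [exact Hk | lra]|].
rewrite Rmult_assoc; apply Rmult_le_compat_l; [|apply step_decay_le, Ht].
assert (H := lipschitz_nonneg k V Hk); lra.
Qed.

Lemma ex_series_decay_bound (C a : R) :
  0 < a -> ex_series (fun n => C * (decay a n - decay a (S n))).
Proof.
intros Ha; apply (ex_series_scal (V := R_NormedModule)); exists 1; apply is_series_decay_step, Ha.
Qed.

Lemma ex_series_alt_term (k : R -> R) (V t : R) :
  bounded_lipschitz k V -> 0 < t -> ex_series (alt_term k t).
Proof.
intros Hk Ht; eapply ex_series_dominated; [|apply ex_series_decay_bound, Ht].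
intros n; apply alt_term_bound; [exact Hk | exact Ht].
Qed.

(** The telescoping majorant has a tail exactly proportional to [decay t (S N)]. For waves the
    dependence on [V] makes the error linear in |v|, which the damping can absorb. *)
Lemma alt_term_tail (k : R -> R) (V t : R) (N : nat) :
  bounded_lipschitz k V -> 0 < t ->
  Rabs (Series (alt_term k t) - sum_n (alt_term k t) N)
  <= (t + V) * (exp t / t) * decay t (S N).
Proof.
intros Hk Ht.
eapply Rle_trans.
- apply Series_tail_le; [|apply ex_series_alt_term with V; assumption | apply ex_series_decay_bound, Ht].
  intros n _; apply alt_term_bound; [exact Hk | exact Ht].
- rewrite Series_scal_l, (is_series_unique _ _ (is_series_decay_step t Ht)).
  apply Req_le.
  transitivity ((t + V) * (exp t / t) * 1 - (t + V) * (exp t / t) * (decay t 0 - decay t (S N))).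
  + f_equal; rewrite <- sum_n_telescope.
    apply (sum_n_mult_l (K := R_AbsRing)).
  + rewrite decay_0; ring.
Qed.

Lemma sum_exp_le (x : R) (K : nat) : 0 <= x -> sum_n (fun k => x ^ k / INR (fact k)) K <= exp x.
Proof.
intros Hx; apply is_series_ge_partial; [|apply is_series_exp].
intros n; apply Rmult_le_pos; [apply pow_le, Hx|].
left; apply Rinv_0_lt_compat, lt_0_INR, lt_O_fact.
Qed.

Lemma sum_exp_diff_le (x y : R) (K : nat) :
  0 <= x <= y ->
  sum_n (fun k => (y ^ k - x ^ k) / INR (fact k)) K <= exp y - exp x.
Proof.
intros Hx; apply is_series_ge_partial.
- intros n; apply Rmult_le_pos.
  + assert (x ^ n <= y ^ n) by (apply pow_incr; lra); lra.
  + left; apply Rinv_0_lt_compat, lt_0_INR, lt_O_fact.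
- apply is_series_ext with (fun k => minus (y ^ k / INR (fact k)) (x ^ k / INR (fact k))).
  + intros n; unfold minus, plus, opp; simpl; unfold Rdiv; ring.
  + apply (is_series_minus (V := R_NormedModule)); apply is_series_exp.
Qed.

(* Taylor coefficients at [t] of [alt_term k _ n]. *)
Definition alt_coef (k : R -> R) (t : R) (n j : nat) : R :=
  (-1) ^ n * (dir_term k t n * (- log_nat n) ^ j - dir_term k t (S n) * (- log_nat (S n)) ^ j)
  / INR (fact j).

Lemma decay_plus (t h : R) (n : nat) : decay (t + h) n = decay t n * exp (- log_nat n * h).
Proof. unfold decay; rewrite <- exp_plus; f_equal; ring. Qed.

Lemma is_series_alt_coef (k : R -> R) (t h : R) (n : nat) :
  is_series (fun j => alt_coef k t n j * h ^ j) (alt_term k (t + h) n).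
Proof.
unfold alt_term, dir_term; rewrite !decay_plus.
set (c0 := (-1) ^ n * dir_term k t n); set (c1 := (-1) ^ n * dir_term k t (S n)).
replace ((-1) ^ n * (k (log_nat n) * (decay t n * exp (- log_nat n * h)) -
   k (log_nat (S n)) * (decay t (S n) * exp (- log_nat (S n) * h))))
 with (minus (scal c0 (exp (- log_nat n * h))) (scal c1 (exp (- log_nat (S n) * h)))).
2:{ unfold minus, plus, opp, scal; simpl; unfold mult, c0, c1, dir_term; simpl; ring. }
apply is_series_ext with (fun j =>
  minus (scal c0 ((- log_nat n * h) ^ j / INR (fact j)))
        (scal c1 ((- log_nat (S n) * h) ^ j / INR (fact j)))).
- intros j; unfold minus, plus, opp, scal; simpl; unfold mult, alt_coef; simpl.
  rewrite !Rpow_mult_distr; unfold c0, c1; field; apply INR_fact_neq_0.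
- apply (is_series_minus (V := R_NormedModule)); apply (is_series_scal (V := R_NormedModule)), is_series_exp.
Qed.

(** Summed against rho^j / j!, powers of the logarithm become exponentials e^x and e^y, which lower
    the decay exponent from t to t - rho. Both resulting pieces, A e^x and B (e^y - e^x), still
    carry a factor of the logarithmic step, so the telescoping majorant applies with exponent t -
    rho. *)
Lemma sum_alt_coef_le (k : R -> R) (V t rho : R) (n K : nat) :
  bounded_lipschitz k V -> 0 < rho -> rho < t ->
  sum_n (fun j => Rabs (alt_coef k t n j) * rho ^ j) K
  <= (t + V + rho) * (exp (t - rho) / (t - rho)) * (decay (t - rho) n - decay (t - rho) (S n)).
Proof.
intros Hk Hr Hrt.
assert (Hs := log_nat_step n); assert (HL := log_nat_nonneg n).
set (A := Rabs (dir_term k t n - dir_term k t (S n))).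
assert (HA : A <= (t + V) * ((log_nat (S n) - log_nat n) * decay t n))
  by (apply dir_term_step; [exact Hk | lra]).
set (B := Rabs (dir_term k t (S n))).
assert (HB : B <= decay t (S n)).
{ unfold B, dir_term; rewrite Rabs_mult, (Rabs_pos_eq (decay t (S n))) by (left; apply decay_pos).
  rewrite <- (Rmult_1_l (decay t (S n))) at 2.
  apply Rmult_le_compat_r; [left; apply decay_pos | apply Hk]. }
assert (HA0 : 0 <= A) by apply Rabs_pos; assert (HB0 : 0 <= B) by apply Rabs_pos.
set (x := rho * log_nat n); set (y := rho * log_nat (S n)).
assert (Hxy : 0 <= x <= y) by (unfold x, y; nra).
apply Rle_trans with (A * exp x + B * (exp y - exp x)).
- apply Rle_trans with
    (sum_n (fun j => A * (x ^ j / INR (fact j)) + B * ((y ^ j - x ^ j) / INR (fact j))) K).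
  + apply sum_n_Rle; intros j.
    assert (Hf : 0 < / INR (fact j)) by apply Rinv_0_lt_compat, lt_0_INR, lt_O_fact.
    unfold alt_coef, Rdiv.
    (* The difference of products is split so that each part contains a difference of consecutive
       quantities; bounding the two products separately would lose the gain from averaging. *)
    replace ((-1) ^ n * (dir_term k t n * (- log_nat n) ^ j - dir_term k t (S n) * (- log_nat (S n)) ^ j))
      with ((-1) ^ n * (-1) ^ j * ((dir_term k t n - dir_term k t (S n)) * log_nat n ^ j
              - dir_term k t (S n) * (log_nat (S n) ^ j - log_nat n ^ j))).
    2:{ replace (- log_nat n) with (-1 * log_nat n) by ring.
        replace (- log_nat (S n)) with (-1 * log_nat (S n)) by ring.
        rewrite !Rpow_mult_distr; ring. }
    rewrite !Rabs_mult, !pow_1_abs, (Rabs_pos_eq (/ INR (fact j))) by lra.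
    assert (Hp : log_nat n ^ j <= log_nat (S n) ^ j) by (apply pow_incr; lra).
    assert (Hp0 : 0 <= log_nat n ^ j) by (apply pow_le; lra).
    assert (H1 : Rabs ((dir_term k t n - dir_term k t (S n)) * log_nat n ^ j
       - dir_term k t (S n) * (log_nat (S n) ^ j - log_nat n ^ j))
       <= A * log_nat n ^ j + B * (log_nat (S n) ^ j - log_nat n ^ j)).
    { unfold Rminus at 1; eapply Rle_trans; [apply Rabs_triang|].
      rewrite Rabs_Ropp, !Rabs_mult, (Rabs_pos_eq (log_nat n ^ j)), (Rabs_pos_eq (_ - log_nat n ^ j)) by lra.
      apply Rle_refl. }
    unfold x, y; rewrite !Rpow_mult_distr.
    assert (Hrj : 0 <= rho ^ j) by (apply pow_le; lra).
    rewrite !Rmult_1_l.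
    replace (A * (rho ^ j * log_nat n ^ j * / INR (fact j)) +
      B * ((rho ^ j * log_nat (S n) ^ j - rho ^ j * log_nat n ^ j) * / INR (fact j)))
     with ((A * log_nat n ^ j + B * (log_nat (S n) ^ j - log_nat n ^ j)) * / INR (fact j) * rho ^ j)
     by ring.
    apply Rmult_le_compat_r; [exact Hrj|].
    apply Rmult_le_compat_r; [lra | exact H1].
  + assert (E : sum_n (fun j => A * (x ^ j / INR (fact j)) + B * ((y ^ j - x ^ j) / INR (fact j))) K
      = A * sum_n (fun j => x ^ j / INR (fact j)) K
        + B * sum_n (fun j => (y ^ j - x ^ j) / INR (fact j)) K).
    { clear; etransitivity; [apply (sum_n_plus (G := R_AbelianMonoid))|].
      apply (f_equal2 Rplus); apply (sum_n_mult_l (K := R_AbsRing)). }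
    rewrite E.
    apply Rplus_le_compat; apply Rmult_le_compat_l; try assumption.
    * apply sum_exp_le; lra.
    * apply sum_exp_diff_le, Hxy.
- set (D := log_nat (S n) - log_nat n) in *.
  apply Rle_trans with ((t + V + rho) * (D * decay (t - rho) n)).
  + assert (E1 : decay t n * exp x = decay (t - rho) n)
      by (unfold decay, x; rewrite <- exp_plus; f_equal; ring).
    assert (E2 : decay t (S n) * exp y = decay (t - rho) (S n))
      by (unfold decay, y; rewrite <- exp_plus; f_equal; ring).
    assert (Hx0 := exp_pos x); assert (Hy0 := exp_pos y).
    assert (H1 : A * exp x <= (t + V) * (D * decay (t - rho) n)).
    { rewrite <- E1.
      replace ((t + V) * (D * (decay t n * exp x))) with ((t + V) * (D * decay t n) * exp x) by ring.
      apply Rmult_le_compat_r; lra. }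
    assert (H2 : exp y - exp x <= rho * D * exp y).
    { replace (exp x) with (exp y * exp (- (rho * D)))
        by (rewrite <- exp_plus; f_equal; unfold x, y, D; ring).
      assert (H := exp_ge_1_plus (- (rho * D))); nra. }
    assert (H3 : B * (exp y - exp x) <= rho * D * decay (t - rho) n).
    { apply Rle_trans with (decay t (S n) * (rho * D * exp y)).
      - assert (exp x <= exp y) by (apply exp_le; lra).
        apply Rmult_le_compat; lra.
      - replace (decay t (S n) * (rho * D * exp y)) with (rho * D * (decay t (S n) * exp y)) by ring.
        rewrite E2; apply Rmult_le_compat_l; [nra | apply decay_decr; lra]. }
    lra.
  + rewrite Rmult_assoc; apply Rmult_le_compat_l.
    * assert (H := lipschitz_nonneg k V Hk); lra.
    * apply step_decay_le; lra.
Qed.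

Lemma real_analytic_Series_alt_term (k : R -> R) (V t : R) :
  bounded_lipschitz k V -> 0 < t -> real_analytic_at (fun y => Series (alt_term k y)) t.
Proof.
intros Hk Ht.
(* The radius t / 2 leaves the positive decay exponent t / 2 in the majorant. *)
exists (fun j => Series (fun n => alt_coef k t n j)), (t / 2); split; [lra|].
intros h Hh; apply is_pseries_R.
apply is_series_ext with (fun j => Series (fun n => alt_coef k t n j * h ^ j)).
- intros j; apply Series_scal_r.
- apply is_series_swap with
    (fun n => (t + V + t / 2) * (exp (t - t / 2) / (t - t / 2)) * (decay (t - t / 2) n - decay (t - t / 2) (S n))).
  + intros n; apply is_series_alt_coef.
  + intros n K; eapply Rle_trans; [|apply (sum_alt_coef_le k V t (t / 2) n K); [exact Hk | lra | lra]].
    apply sum_n_Rle; intros j; rewrite Rabs_mult, <- RPow_abs.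
    apply Rmult_le_compat_l; [apply Rabs_pos|].
    apply pow_incr; split; [apply Rabs_pos | lra].
  + apply ex_series_decay_bound; lra.
Qed.

Lemma real_analytic_eta (k : R -> R) (V t : R) :
  bounded_lipschitz k V -> 0 < t -> real_analytic_at (eta k) t.
Proof.
intros Hk Ht.
apply real_analytic_ext with
  (fun y => / 2 * (k 0 + Series (alt_term k y))).
- intros y; unfold eta, dir_term; rewrite decay_0, log_nat_0; field.
- apply real_analytic_scal, real_analytic_plus; [apply real_analytic_const|].
  apply real_analytic_Series_alt_term with V; assumption.
Qed.

(** * Continuation of zeta to the critical line *)

Ltac eqR := lazymatch goal with |- @eq _ ?a ?b => change (@eq R a b) end.

(* The real part of [e^(i th) z]. *)
Definition Re_rot (th : R) (z : C) : R := cos th * Re z - sin th * Im z.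

Lemma Re_rot_le (th : R) (z : C) : Rabs (Re_rot th z) <= 2 * Cmod z.
Proof.
unfold Re_rot, Rminus; eapply Rle_trans; [apply Rabs_triang|].
rewrite Rabs_Ropp, !Rabs_mult.
assert (H1 : Rabs (cos th) <= 1) by (apply Rabs_le, COS_bound).
assert (H2 : Rabs (sin th) <= 1) by (apply Rabs_le, SIN_bound).
assert (H3 := Rmax_Cmod z).
assert (H4 := Rmax_l (Rabs (fst z)) (Rabs (snd z))).
assert (H5 := Rmax_r (Rabs (fst z)) (Rabs (snd z))).
assert (H6 := Rabs_pos (fst z)); assert (H7 := Rabs_pos (snd z)).
assert (H8 := Rabs_pos (cos th)); assert (H9 := Rabs_pos (sin th)).
unfold Re, Im; nra.
Qed.

Lemma is_series_Re_rot (th : R) (a : nat -> C) (l : C) :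
  @is_series C_AbsRing C_NormedModule a l -> is_series (fun n => Re_rot th (a n)) (Re_rot th l).
Proof.
intros H.
assert (E : forall N, sum_n (fun n => Re_rot th (a n)) N = Re_rot th (@sum_n C_NormedModule a N)).
{ induction N as [|N IH]; [rewrite !sum_O; reflexivity|].
  rewrite !sum_Sn, IH; unfold plus, Re_rot, Re, Im; simpl; unfold plus; simpl; ring. }
apply is_series_Rlim, is_lim_seq_eps; intros eps He.
assert (He4 : 0 < eps / 4) by lra.
destruct (proj1 (@filterlim_locally_ball_norm C_AbsRing nat C_NormedModule eventually _ _ l) H
  (mkposreal _ He4)) as [N HN].
exists N; intros n Hn; specialize (HN n Hn).
unfold ball_norm in HN; simpl in HN.
rewrite E.
replace (Re_rot th (@sum_n C_NormedModule a n) - Re_rot th l) with (Re_rot th (minus (@sum_n C_NormedModule a n) l)).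
2:{ destruct l as [lr li]; destruct (@sum_n C_NormedModule a n) as [xr xi].
    unfold Re_rot; simpl; ring. }
eapply Rle_trans; [apply Re_rot_le|].
unfold norm in HN; simpl in HN; lra.
Qed.

Lemma pow_n_RtoC (x : R) (k : nat) : @pow_n C_AbsRing (RtoC x) k = RtoC (x ^ k).
Proof.
induction k as [|k IH]; [reflexivity|].
simpl; rewrite IH; unfold mult; simpl; rewrite <- RtoC_mult; reflexivity.
Qed.

(** Only real increments of the complex variable are taken. Their powers are real, so the
    real-linear map [Re_rot th] can be applied coefficient by coefficient. *)
Lemma real_analytic_Re_rot (zeta : C -> C) (th t v : R) :
  analytic_at zeta (t, v) -> real_analytic_at (fun y => Re_rot th (zeta (y, v))) t.
Proof.
intros (a & d & Hd & Ha).
exists (fun k => Re_rot th (a k)), d; split; [exact Hd|].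
intros h Hh; apply is_pseries_R.
specialize (Ha (RtoC h)); rewrite Cmod_R in Ha; specialize (Ha Hh).
apply (is_series_Re_rot th) in Ha.
replace ((t, v) + RtoC h)%C with ((t + h, v) : C) in Ha
  by (unfold Cplus, RtoC; simpl; f_equal; ring).
apply is_series_ext with (2 := Ha); intros k.
rewrite pow_n_RtoC; unfold scal, Re_rot, Re, Im; simpl; unfold mult; simpl; ring.
Qed.

(** The alternating sum is the full sum minus twice its odd-indexed part, and 2 k + 1 <= N + 1 means
    k <= N / 2. The upper limit [S N] ensures that the odd part has at least one term, as [sum_n]
    always does. *)
Lemma div2_alt_sum (a : nat -> R) (N : nat) :
  sum_n (fun n => (-1) ^ n * a n) (S N)
  = sum_n a (S N) - 2 * sum_n (fun k => a (2 * k + 1)%nat) (Nat.div2 N).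
Proof.
induction N as [|N IH].
- rewrite !sum_Sn, !sum_O; unfold plus; simpl; eqR; ring.
- rewrite sum_Sn, IH, (sum_Sn a (S N)); unfold plus; cbn -[pow Nat.div2 Nat.mul sum_n]; eqR.
  destruct (Nat.Even_or_Odd N) as [[m Hm]|[m Hm]]; subst N.
  + replace (Nat.div2 (S (2 * m))) with (Nat.div2 (2 * m)) by (rewrite Nat.div2_double, Nat.div2_succ_double; reflexivity).
    replace ((-1) ^ S (S (2 * m))) with 1; [ring|].
    replace (S (S (2 * m))) with (2 * S m)%nat by lia; symmetry; apply pow_1_even.
  + replace (S (2 * m + 1)) with (2 * S m)%nat by lia.
    replace (2 * m + 1)%nat with (S (2 * m)) by lia.
    rewrite Nat.div2_double, Nat.div2_succ_double, sum_Sn; unfold plus; cbn -[pow Nat.div2 Nat.mul sum_n]; eqR.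
    rewrite pow_1_odd; replace (2 * S m + 1)%nat with (S (2 * S m)) by lia; ring.
Qed.

Lemma is_lim_seq_div2 (u : nat -> R) (l : R) :
  is_lim_seq u l -> is_lim_seq (fun n => u (Nat.div2 n)) l.
Proof.
intros H; apply filterlim_comp with (2 := H).
intros P [N HN]; exists (2 * N)%nat; intros n Hn; apply HN.
apply Nat.div2_le_mono in Hn; rewrite Nat.div2_double in Hn; exact Hn.
Qed.

(** With A_N the partial sums of the alternating series, the averaged partial sums are A_N + A_(N+1)
    - a_0. Odd indices correspond to even integers, so [E0] is the sum over the latter. *)
Lemma is_series_alternating (a : nat -> R) (S0 E0 : R) :
  is_series a S0 -> is_series (fun k => a (2 * k + 1)%nat) E0 ->
  is_series (fun n => (-1) ^ n * (a n - a (S n))) (2 * (S0 - 2 * E0) - a 0%nat).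
Proof.
intros HS HE.
assert (HA : is_lim_seq (sum_n (fun n => (-1) ^ n * a n)) (S0 - 2 * E0)).
{ apply is_lim_seq_incr_1.
  apply is_lim_seq_ext with
    (fun N => sum_n a (S N) - 2 * sum_n (fun k => a (2 * k + 1)%nat) (Nat.div2 N)).
  - intros N; symmetry; apply div2_alt_sum.
  - apply is_lim_seq_minus'.
    + apply -> is_lim_seq_incr_1; exact HS.
    + apply (is_lim_seq_scal_l _ 2 E0).
      apply (is_lim_seq_div2 _ _ HE). }
apply is_series_Rlim.
apply is_lim_seq_ext with
  (fun N => sum_n (fun n => (-1) ^ n * a n) N + sum_n (fun n => (-1) ^ n * a n) (S N) - a 0%nat).
- induction n as [|n IH].
  + rewrite !sum_Sn, !sum_O; unfold plus; simpl; ring.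
  + rewrite (sum_Sn (fun n0 => (-1) ^ n0 * (a n0 - a (S n0)))), <- IH.
    rewrite !(sum_Sn (fun n0 => (-1) ^ n0 * a n0)); unfold plus; simpl; ring.
- replace (2 * (S0 - 2 * E0) - a 0%nat) with ((S0 - 2 * E0) + (S0 - 2 * E0) - a 0%nat) by ring.
  apply is_lim_seq_minus'; [|apply is_lim_seq_const].
  apply is_lim_seq_plus'; [exact HA|].
  apply -> is_lim_seq_incr_1; exact HA.
Qed.

Definition wave (th v : R) (x : R) : R := cos (th - v * x).

Lemma cos_lipschitz (x y : R) : Rabs (cos x - cos y) <= Rabs (x - y).
Proof.
destruct (MVT_gen cos y x (fun z => - sin z)) as [c [_ Hc]].
- intros z _; auto_derive; [exact I | ring].
- intros z _; apply continuity_cos.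
- rewrite Hc, Rabs_mult, Rabs_Ropp.
  rewrite <- (Rmult_1_l (Rabs (x - y))) at 2.
  apply Rmult_le_compat_r; [apply Rabs_pos | apply Rabs_le, SIN_bound].
Qed.

Lemma bounded_lipschitz_wave (th v : R) : bounded_lipschitz (wave th v) (Rabs v).
Proof.
split; intros x.
- apply Rabs_le, COS_bound.
- intros y; unfold wave; eapply Rle_trans; [apply cos_lipschitz|].
  replace (th - v * x - (th - v * y)) with (- v * (x - y)) by ring.
  rewrite Rabs_mult, Rabs_Ropp; apply Rle_refl.
Qed.

Lemma Re_rot_Rcpow (th t v : R) (n : nat) :
  Re_rot th (Rcpow (INR (S n)) (- ((t, v) : C))%C) = dir_term (wave th v) t n.
Proof.
unfold Re_rot, Rcpow, Cexp, dir_term, wave, decay; fold (log_nat n).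
unfold Copp, Cmult, RtoC, Re, Im; simpl.
rewrite !Rmult_0_r, Rplus_0_l, Rminus_0_r.
replace (th - v * log_nat n) with (th + - v * log_nat n) by ring.
rewrite cos_plus; ring.
Qed.

Lemma is_series_zeta (zeta : C -> C) (th t v : R) :
  is_riemann_zeta zeta -> 1 < t -> is_series (dir_term (wave th v) t) (Re_rot th (zeta (t, v))).
Proof.
intros [Hz _] Ht.
specialize (Hz (t, v) Ht).
apply (is_series_Re_rot th) in Hz.
apply is_series_ext with (2 := Hz); intros n; apply Re_rot_Rcpow.
Qed.

Lemma log_nat_double (k : nat) : log_nat (2 * k + 1) = ln 2 + log_nat k.
Proof.
unfold log_nat; rewrite <- ln_mult by (lra || (apply lt_0_INR; lia)).
f_equal; replace (S (2 * k + 1)) with (2 * S k)%nat by lia.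
rewrite mult_INR; reflexivity.
Qed.

Lemma decay_exp (t x : R) (n : nat) : exp (- t * (x + log_nat n)) = exp (- t * x) * decay t n.
Proof. unfold decay; rewrite <- exp_plus; f_equal; ring. Qed.

(** From (2 m)^(-s) = 2^(-s) m^(-s): the modulus of 2^(-s) comes out as the exponential factor, and
    its argument turns the angle [th] by - v ln 2. *)
Lemma is_series_zeta_double (zeta : C -> C) (th t v : R) :
  is_riemann_zeta zeta -> 1 < t ->
  is_series (fun k => dir_term (wave th v) t (2 * k + 1))
    (exp (- t * ln 2) * Re_rot (th - v * ln 2) (zeta (t, v))).
Proof.
intros Hz Ht.
assert (H := is_series_zeta zeta (th - v * ln 2) t v Hz Ht).
apply (is_series_scal (V := R_NormedModule) (exp (- t * ln 2))) in H.
apply is_series_ext with (2 := H); intros n.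
unfold dir_term, decay at 2; rewrite log_nat_double, decay_exp.
unfold scal; simpl; unfold mult, wave; simpl.
replace (th - v * (ln 2 + log_nat n)) with (th - v * ln 2 - v * log_nat n) by ring; ring.
Qed.

Lemma eta_eq_gt_1 (zeta : C -> C) (th t v : R) :
  is_riemann_zeta zeta -> 1 < t ->
  eta (wave th v) t
  = Re_rot th (zeta (t, v)) - 2 * (exp (- t * ln 2) * Re_rot (th - v * ln 2) (zeta (t, v))).
Proof.
intros Hz Ht; unfold eta, alt_term.
rewrite (is_series_unique _ _ (is_series_alternating _ _ _
  (is_series_zeta zeta th t v Hz Ht) (is_series_zeta_double zeta th t v Hz Ht))).
field.
Qed.

(** The condition v <> 0 keeps the horizontal line away from the point 1, so [zeta] is analytic
    along all of it, including where the abscissa passes 1. *)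
Lemma eta_eq (zeta : C -> C) (th t v : R) :
  is_riemann_zeta zeta -> v <> 0 -> 0 < t ->
  eta (wave th v) t
  = Re_rot th (zeta (t, v)) - 2 * (exp (- t * ln 2) * Re_rot (th - v * ln 2) (zeta (t, v))).
Proof.
intros Hz Hv Ht.
apply Rminus_diag_uniq.
apply (real_analytic_identity (fun t => eta (wave th v) t -
  (Re_rot th (zeta (t, v)) - 2 * (exp (- t * ln 2) * Re_rot (th - v * ln 2) (zeta (t, v))))) t 1);
  [| |apply Rle_refl].
- intros x Hx.
  assert (Hza : forall th', real_analytic_at (fun y => Re_rot th' (zeta (y, v))) x).
  { intros th'; apply real_analytic_Re_rot, Hz.
    intros E; apply Hv; exact (f_equal snd E). }
  apply real_analytic_ext with (fun t => eta (wave th v) t + (-1 * Re_rot th (zeta (t, v)) +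
    2 * (exp (- ln 2 * t) * Re_rot (th - v * ln 2) (zeta (t, v))))).
  + intros y; replace (- ln 2 * y) with (- y * ln 2) by ring; ring.
  + apply real_analytic_plus.
    * apply real_analytic_eta with (Rabs v); [apply bounded_lipschitz_wave | lra].
    * apply real_analytic_plus; apply real_analytic_scal; [apply Hza|].
      apply real_analytic_mult; [apply real_analytic_exp | apply Hza].
- intros x Hx; rewrite (eta_eq_gt_1 zeta) by assumption; apply Rminus_diag; reflexivity.
Qed.

(** * Improper integrals *)

(** A limit of proper integrals suffices for the working integrands, which are continuous on the
    whole line; [improper_is_RInt_gen] converts the final result to [is_RInt_gen]. *)
Definition improper (f : R -> R) (l : R) : Prop :=
  is_lim (fun A => RInt f 0 A) p_infty l.

Lemma ex_RInt_cont (f : R -> R) (a b : R) : (forall v, continuous f v) -> ex_RInt f a b.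
Proof. intros H; apply (ex_RInt_continuous (V := R_CompleteNormedModule)); intros z _; apply H. Qed.

Lemma RInt_exp_decay (C d a b : R) :
  0 < d -> RInt (fun v => C * exp (- d * v)) a b = C / d * (exp (- d * a) - exp (- d * b)).
Proof.
intros Hd; apply is_RInt_unique.
replace (C / d * (exp (- d * a) - exp (- d * b)))
  with (minus (- (C / d) * exp (- d * b)) (- (C / d) * exp (- d * a)))
  by (unfold minus, plus, opp; simpl; ring).
apply (is_RInt_derive (V := R_CompleteNormedModule) (fun v => - (C / d) * exp (- d * v))).
- intros x _; auto_derive; [exact I | field; lra].
- intros x _; apply (ex_derive_continuous (V := R_NormedModule)); auto_derive; exact I.
Qed.

Lemma RInt_Rabs_le (f g : R -> R) (a b : R) :
  a <= b -> (forall v, continuous f v) -> (forall v, continuous g v) ->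
  (forall v, a <= v <= b -> Rabs (f v) <= g v) -> Rabs (RInt f a b) <= RInt g a b.
Proof.
intros Hab Hf Hg H.
eapply Rle_trans; [apply abs_RInt_le; [exact Hab | apply ex_RInt_cont, Hf]|].
apply RInt_le; [exact Hab | | apply ex_RInt_cont, Hg | intros x Hx; apply H; lra].
apply ex_RInt_cont; intros v; apply (continuous_comp f Rabs); [apply Hf | apply continuous_Rabs].
Qed.

Lemma continuous_exp_decay (C d v : R) : continuous (fun v => C * exp (- d * v)) v.
Proof. apply (ex_derive_continuous (V := R_NormedModule)); auto_derive; exact I. Qed.

Lemma RInt_decay_bound (f : R -> R) (C d a b : R) :
  0 < d -> 0 <= a <= b -> (forall v, continuous f v) ->
  (forall v, 0 <= v -> Rabs (f v) <= C * exp (- d * v)) ->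
  Rabs (RInt f a b) <= C / d * exp (- d * a).
Proof.
intros Hd Hab Hf H.
assert (HC : 0 <= C).
{ specialize (H 0 (Rle_refl 0)); rewrite Rmult_0_r, exp_0 in H.
  assert (H0 := Rabs_pos (f 0)); lra. }
eapply Rle_trans.
- apply (RInt_Rabs_le f (fun v => C * exp (- d * v))); [lra | exact Hf | intros v; apply continuous_exp_decay |].
  intros v Hv; apply H; lra.
- rewrite RInt_exp_decay by exact Hd.
  apply Rmult_le_compat_l; [apply Rdiv_le_0_compat; lra|].
  assert (H0 := exp_pos (- d * b)); lra.
Qed.

Lemma is_lim_p_infty_eps (F : R -> R) (l : R) :
  is_lim F p_infty l <->
  (forall eps, 0 < eps -> exists M, forall A, M < A -> Rabs (F A - l) < eps).
Proof.
split.
- intros H eps He; apply is_lim_spec in H; exact (H (mkposreal eps He)).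
- intros H; apply is_lim_spec; intros eps; exact (H eps (cond_pos eps)).
Qed.

Lemma is_lim_exp_decay (C d : R) : 0 < d -> is_lim (fun A => C * exp (- d * A)) p_infty 0.
Proof.
intros Hd.
replace (Finite 0) with (Rbar_mult C 0) by (simpl; f_equal; ring).
apply is_lim_scal_l.
apply is_lim_comp with m_infty; [apply is_lim_exp_m | | exists 0; intros y _; discriminate].
replace m_infty with (Rbar_mult (- d) p_infty).
- apply is_lim_scal_l, is_lim_id.
- simpl; destruct (Rle_dec 0 (- d)) as [H|H]; [exfalso; lra | reflexivity].
Qed.

Lemma is_lim_Rabs_le (F : R -> R) (l B M : R) :
  is_lim F p_infty l -> (forall A, M < A -> Rabs (F A) <= B) -> Rabs l <= B.
Proof.
intros Hl H.
apply Rle_plus_epsilon; intros eps He.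
destruct (proj1 (is_lim_p_infty_eps F l) Hl eps He) as [M' HM'].
set (A := Rmax M M' + 1).
assert (H1 := Rmax_l M M'); assert (H2 := Rmax_r M M').
specialize (H A ltac:(unfold A; lra)); specialize (HM' A ltac:(unfold A; lra)).
replace l with (F A + - (F A - l)) by ring.
eapply Rle_trans; [apply Rabs_triang|]; rewrite Rabs_Ropp; lra.
Qed.

Lemma improper_exists (f : R -> R) (C d : R) :
  0 < d -> (forall v, continuous f v) ->
  (forall v, 0 <= v -> Rabs (f v) <= C * exp (- d * v)) ->
  exists l, improper f l.
Proof.
intros Hd Hf H.
apply (filterlim_locally_cauchy (U := R_CompleteSpace) (F := Rbar_locally p_infty)).
intros eps.
destruct (proj1 (is_lim_p_infty_eps _ _) (is_lim_exp_decay (C / d) d Hd) eps (cond_pos eps)) as [M HM].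
exists (fun A => Rmax M 0 < A); split; [exists (Rmax M 0); intros x Hx; exact Hx|].
assert (Hle : forall u v, Rmax M 0 < u -> u <= v -> Rabs (RInt f 0 v - RInt f 0 u) < eps).
{ intros u v Hu Huv.
  assert (Hm1 := Rmax_l M 0); assert (Hm2 := Rmax_r M 0).
  assert (E : RInt f 0 v - RInt f 0 u = RInt f u v).
  { rewrite <- (RInt_Chasles f 0 u v) by (apply ex_RInt_cont, Hf); unfold plus; simpl; ring. }
  rewrite E; eapply Rle_lt_trans; [apply (RInt_decay_bound f C d u v); [exact Hd | lra | exact Hf | exact H]|].
  specialize (HM u ltac:(lra)); rewrite Rminus_0_r in HM; apply Rabs_def2 in HM; lra. }
intros u v Hu Hv.
destruct (Rle_lt_dec u v) as [Huv|Huv].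
- change (Rabs (RInt f 0 v - RInt f 0 u) < eps); apply Hle; assumption.
- change (Rabs (RInt f 0 v - RInt f 0 u) < eps); rewrite Rabs_minus_sym; apply Hle; [assumption | lra].
Qed.

Lemma improper_bound (f : R -> R) (C d l : R) :
  0 < d -> (forall v, continuous f v) ->
  (forall v, 0 <= v -> Rabs (f v) <= C * exp (- d * v)) ->
  improper f l -> Rabs l <= C / d.
Proof.
intros Hd Hf H Hl; apply (is_lim_Rabs_le _ l (C / d) 0 Hl).
intros A HA; replace (C / d) with (C / d * exp (- d * 0)) by (rewrite Rmult_0_r, exp_0; ring).
apply RInt_decay_bound; [exact Hd | lra | exact Hf | exact H].
Qed.

Lemma improper_plus (f g : R -> R) (lf lg : R) :
  (forall v, continuous f v) -> (forall v, continuous g v) ->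
  improper f lf -> improper g lg -> improper (fun v => f v + g v) (lf + lg).
Proof.
intros Hf Hg H1 H2.
apply is_lim_ext with (fun A => RInt f 0 A + RInt g 0 A).
- intros A; symmetry; apply (RInt_plus (V := R_CompleteNormedModule) f g); apply ex_RInt_cont; assumption.
- apply is_lim_plus'; assumption.
Qed.

Lemma improper_scal (c : R) (f : R -> R) (lf : R) :
  (forall v, continuous f v) -> improper f lf -> improper (fun v => c * f v) (c * lf).
Proof.
intros Hf H1.
apply is_lim_ext with (fun A => c * RInt f 0 A).
- intros A; symmetry; apply (RInt_scal (V := R_CompleteNormedModule) f); apply ex_RInt_cont; assumption.
- apply (is_lim_scal_l _ c p_infty lf), H1.
Qed.

Lemma improper_ext (f g : R -> R) (l : R) :
  (forall v, 0 < v -> f v = g v) -> improper f l -> improper g l.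
Proof.
intros H; apply is_lim_ext_loc; exists 0; intros A HA.
apply RInt_ext; intros v Hv; apply H; rewrite Rmin_left in Hv; lra.
Qed.

(** The function [g] inherits integrability from [f], with which it need agree only for v > 0. This
    disposes of the point v = 0 excluded by [eta_eq]. *)
Lemma improper_is_RInt_gen (f g : R -> R) (l : R) :
  (forall v, continuous f v) -> (forall v, 0 < v -> f v = g v) -> improper f l ->
  is_RInt_gen g (at_point 0) (Rbar_locally p_infty) l.
Proof.
intros Hf Hfg Hl P HP; specialize (Hl P HP).
destruct Hl as [M HM].
apply (Filter_prod _ _ _ (fun x => x = 0) (fun A => Rmax M 0 < A)).
- reflexivity.
- exists (Rmax M 0); intros x Hx; exact Hx.
- intros x A -> HA; simpl.
  assert (Hm1 := Rmax_l M 0); assert (Hm2 := Rmax_r M 0).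
  exists (RInt f 0 A); split; [|apply HM; lra].
  apply (is_RInt_ext f g); [|apply (RInt_correct (V := R_CompleteNormedModule)), ex_RInt_cont, Hf].
  intros v Hv; apply Hfg; rewrite Rmin_left in Hv; lra.
Qed.

(** * Hyperbolic functions *)

Lemma cosh_pos (x : R) : 0 < cosh x.
Proof. unfold cosh; assert (H1 := exp_pos x); assert (H2 := exp_pos (- x)); lra. Qed.

Lemma cosh_neq_0 (x : R) : cosh x <> 0.
Proof. assert (H := cosh_pos x); lra. Qed.

Lemma cosh_sinh_sq (x : R) : cosh x * cosh x - sinh x * sinh x = 1.
Proof.
unfold cosh, sinh.
replace 1 with (exp x * exp (- x)) by (rewrite <- exp_plus, Rplus_opp_r; apply exp_0); field.
Qed.

Lemma cosh_minus (x y : R) : cosh (x - y) = cosh x * cosh y - sinh x * sinh y.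
Proof.
unfold cosh, sinh.
replace (- (x - y)) with (- x + y) by ring; unfold Rminus; rewrite !exp_plus; field.
Qed.

Lemma sinh_minus (x y : R) : sinh (x - y) = sinh x * cosh y - cosh x * sinh y.
Proof.
unfold cosh, sinh.
replace (- (x - y)) with (- x + y) by ring; unfold Rminus; rewrite !exp_plus; field.
Qed.

Lemma sinh_abs_le_cosh (x : R) : Rabs (sinh x) <= cosh x.
Proof.
unfold cosh, sinh; assert (H1 := exp_pos x); assert (H2 := exp_pos (- x)).
apply Rabs_le; lra.
Qed.

Lemma cosh_le_exp_Rabs (x : R) : cosh x <= exp (Rabs x).
Proof.
unfold cosh.
assert (exp x <= exp (Rabs x)) by (apply exp_le, Rle_abs).
assert (exp (- x) <= exp (Rabs x)) by (apply exp_le; rewrite <- Rabs_Ropp; apply Rle_abs).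
lra.
Qed.

Lemma cosh_ge_exp (x : R) : exp x / 2 <= cosh x.
Proof. unfold cosh; assert (H := exp_pos (- x)); lra. Qed.

(** Here sinh x = e^x (1 - e^(-2x)) / 2, and 1 - e^(-2x) <= 2x. The factor x is what later produces
    a factor e in sinh (e v). *)
Lemma sinh_le_mul_exp (x : R) : 0 <= x -> sinh x <= x * exp x.
Proof.
intros Hx; unfold sinh.
replace (exp (- x)) with (exp x * exp (- (2 * x))) by (rewrite <- exp_plus; f_equal; ring).
assert (H := exp_ge_1_plus (- (2 * x))); assert (H0 := exp_pos x); nra.
Qed.

(** * The damping factor and its cosine transform *)

Definition damp (phi v : R) : R := cosh (phi * v) / cosh (PI * v).

Lemma damp_bound (phi v : R) :
  0 <= v -> 0 <= damp phi v <= 2 * exp (- (PI - Rabs phi) * v).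
Proof.
intros Hv; unfold damp.
assert (H1 := cosh_pos (phi * v)); assert (H2 := cosh_pos (PI * v)).
split; [apply Rdiv_le_0_compat; lra|].
apply Rle_div_l; [lra|].
assert (H3 := cosh_le_exp_Rabs (phi * v)); rewrite Rabs_mult, (Rabs_pos_eq v) in H3 by lra.
assert (H4 := cosh_ge_exp (PI * v)).
assert (H5 := exp_pos (- (PI - Rabs phi) * v)).
replace (exp (Rabs phi * v)) with (exp (- (PI - Rabs phi) * v) * exp (PI * v)) in H3
  by (rewrite <- exp_plus; f_equal; ring).
nra.
Qed.

Definition damp' (e v : R) : R :=
  e * sinh (e * v) - PI * sinh (e * v) / cosh (PI * v) ^ 2
  - e * (sinh (PI * v) / cosh (PI * v)) * cosh (e * v).

(** The second derivative of [damp (PI - e)], arranged for estimation: the parts e^2 cosh (e v) and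
    e^2 tanh ([PI] v) sinh (e v), which grow separately, are recombined into e^2 times the damping
    factor, and each remaining term is small with e and decays exponentially. *)
Definition damp'' (e v : R) : R :=
  e ^ 2 * damp (PI - e) v
  + 2 * PI ^ 2 * sinh (PI * v) * sinh (e * v) / cosh (PI * v) ^ 3
  - 2 * e * PI * cosh (e * v) / cosh (PI * v) ^ 2.

Lemma damp_eq (e v : R) :
  damp (PI - e) v = cosh (e * v) - sinh (PI * v) / cosh (PI * v) * sinh (e * v).
Proof.
unfold damp; replace ((PI - e) * v) with (PI * v - e * v) by ring.
rewrite cosh_minus; field; apply cosh_neq_0.
Qed.

Lemma is_derive_damp (e v : R) : is_derive (damp (PI - e)) v (damp' e v).
Proof.
apply is_derive_ext with (fun v => cosh (e * v) - sinh (PI * v) / cosh (PI * v) * sinh (e * v)).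
- intros t; symmetry; apply damp_eq.
- auto_derive; [apply cosh_neq_0|]; unfold damp'.
  assert (Hc := cosh_neq_0 (PI * v)); assert (Hs := cosh_sinh_sq (PI * v)).
  set (c := cosh (PI * v)) in *; set (s := sinh (PI * v)) in *.
  (* The relation c^2 - s^2 = 1 is inserted by hand, since [field] treats [c] and [s] as
     independent. *)
  replace (PI * sinh (e * v) / c ^ 2)
    with (PI * sinh (e * v) * (c * c - s * s) / c ^ 2) by (rewrite Hs; field; exact Hc).
  field; exact Hc.
Qed.

Lemma is_derive_damp' (e v : R) : is_derive (damp' e) v (damp'' e v).
Proof.
unfold damp'; auto_derive.
- assert (Hc := cosh_neq_0 (PI * v)); repeat split; try exact Hc.
  apply Rmult_integral_contrapositive; split; [exact Hc|].
  apply Rmult_integral_contrapositive; split; [exact Hc | lra].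
- unfold damp''; rewrite damp_eq.
  assert (Hc := cosh_neq_0 (PI * v)); assert (Hs := cosh_sinh_sq (PI * v)).
  set (c := cosh (PI * v)) in *; set (s := sinh (PI * v)) in *.
  replace (2 * e * PI * cosh (e * v) / c ^ 2)
    with (e * PI * cosh (e * v) / c ^ 2 + e * PI * cosh (e * v) * (c * c - s * s) / c ^ 2)
    by (rewrite Hs; field; exact Hc).
  field; exact Hc.
Qed.

Lemma continuous_damp (phi v : R) : continuous (damp phi) v.
Proof.
replace phi with (PI - (PI - phi)) by ring.
apply (ex_derive_continuous (V := R_NormedModule)); eexists; apply is_derive_damp.
Qed.

Lemma continuous_damp'' (e v : R) : continuous (damp'' e) v.
Proof.
apply (ex_derive_continuous (V := R_NormedModule)); unfold damp'', damp; auto_derive.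
assert (Hc := cosh_neq_0 (PI * v)); repeat split; try exact Hc;
  repeat (exact Hc || exact R1_neq_R0 || (apply Rmult_integral_contrapositive; split)).
Qed.

Lemma PI_gt_3 : 3 < PI.
Proof. assert (H := PI2_3_2); unfold PI2 in H; lra. Qed.

Lemma damp'_0 (e : R) : damp' e 0 = 0.
Proof.
unfold damp'; rewrite !Rmult_0_r, sinh_0, cosh_0; field.
Qed.

(** In the defining formula terms grow like e^(e v) and cancel. The quotient rule applied to cosh
    (([PI] - e) v) / cosh ([PI] v) gives two terms without cancellation, each at most [PI] times
    twice e^(- e v). *)
Lemma damp'_bound (e v : R) :
  0 <= e <= PI -> 0 <= v -> Rabs (damp' e v) <= 4 * PI * exp (- e * v).
Proof.
intros He Hv.
assert (E : damp' e v = (PI - e) * (sinh ((PI - e) * v) / cosh (PI * v))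
    - PI * (damp (PI - e) v * (sinh (PI * v) / cosh (PI * v)))).
{ unfold damp', damp; replace ((PI - e) * v) with (PI * v - e * v) by ring.
  rewrite cosh_minus, sinh_minus.
  assert (Hc := cosh_neq_0 (PI * v)); assert (Hs := cosh_sinh_sq (PI * v)).
  set (c := cosh (PI * v)) in *; set (s := sinh (PI * v)) in *.
  replace (PI * sinh (e * v) / c ^ 2)
    with (PI * sinh (e * v) * (c * c - s * s) / c ^ 2) by (rewrite Hs; field; exact Hc).
  field; exact Hc. }
rewrite E; unfold Rminus at 1.
assert (Hd := damp_bound (PI - e) v Hv); rewrite (Rabs_pos_eq (PI - e)) in Hd by lra.
replace (- (PI - (PI - e)) * v) with (- e * v) in Hd by ring.
assert (Hc := cosh_pos (PI * v)).
assert (H1 : Rabs (sinh ((PI - e) * v) / cosh (PI * v)) <= damp (PI - e) v).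
{ unfold damp, Rdiv; rewrite Rabs_mult, (Rabs_pos_eq (/ _)) by (left; apply Rinv_0_lt_compat, Hc).
  apply Rmult_le_compat_r; [left; apply Rinv_0_lt_compat, Hc | apply sinh_abs_le_cosh]. }
assert (H2 : Rabs (sinh (PI * v) / cosh (PI * v)) <= 1).
{ unfold Rdiv; rewrite Rabs_mult, (Rabs_pos_eq (/ _)) by (left; apply Rinv_0_lt_compat, Hc).
  apply Rle_div_l; [exact Hc|]; rewrite Rmult_1_l; apply sinh_abs_le_cosh. }
eapply Rle_trans; [apply Rabs_triang|]; rewrite Rabs_Ropp.
set (a := sinh ((PI - e) * v) / cosh (PI * v)) in *.
set (b := sinh (PI * v) / cosh (PI * v)) in *.
rewrite !Rabs_mult, (Rabs_pos_eq (PI - e)), (Rabs_pos_eq PI), (Rabs_pos_eq (damp _ _)) by lra.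
assert (H3 := Rabs_pos a); assert (H4 := Rabs_pos b).
set (x := exp (- e * v)) in *.
apply Rle_trans with (PI * (2 * x) + PI * ((2 * x) * 1)); [|lra].
apply Rplus_le_compat.
- apply Rmult_le_compat; lra.
- apply Rmult_le_compat_l; [lra|]; apply Rmult_le_compat; lra.
Qed.

(** The two summands come from the last two terms of [damp'']: the one with cosh^3 and the one with
    cosh^2 in the denominator. *)
Definition damp_const : R := 8 * PI ^ 2 + 8 * PI.

(** The term e^2 [damp] keeps the slow rate e but has two factors e. The other two terms have one
    factor e, and there 1 / cosh^2 ([PI] v) <= 4 e^(-2 [PI] v) overcomes sinh (e v) <= e e^(2 v) and
    cosh (e v) <= e^(2 v). *)
Lemma damp''_bound (e v : R) :
  0 <= e <= 1 -> 0 <= v ->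
  Rabs (damp'' e v) <= 2 * e ^ 2 * exp (- e * v) + e * damp_const * exp (- 1 * v).
Proof.
intros He Hv.
assert (HPI := PI_gt_3).
assert (Hd := damp_bound (PI - e) v Hv); rewrite (Rabs_pos_eq (PI - e)) in Hd by lra.
replace (- (PI - (PI - e)) * v) with (- e * v) in Hd by ring.
assert (Hc := cosh_pos (PI * v)); assert (Hsc := sinh_abs_le_cosh (PI * v)).
assert (Hce := cosh_ge_exp (PI * v)).
assert (Hi : / cosh (PI * v) <= 2 * exp (- (PI * v))).
{ rewrite exp_Ropp; apply Rle_trans with (/ (exp (PI * v) / 2)).
  - apply Rinv_le_contravar; [|exact Hce]; assert (H := exp_pos (PI * v)); lra.
  - right; field; apply Rgt_not_eq, exp_pos. }
assert (Hi0 : 0 < / cosh (PI * v)) by apply Rinv_0_lt_compat, Hc.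
set (i := / cosh (PI * v)) in *.
assert (Hev : 0 <= e * v <= v) by nra.
assert (Hv1 : exp (e * v) <= exp v) by (apply exp_le; lra).
assert (Hv2 := exp_ge_1_plus v).
assert (Hsh : 0 <= sinh (e * v) <= e * exp (2 * v)).
{ split.
  - unfold sinh; assert (exp (- (e * v)) <= exp (e * v)) by (apply exp_le; lra); lra.
  - eapply Rle_trans; [apply sinh_le_mul_exp; lra|].
    replace (exp (2 * v)) with (exp v * exp v) by (rewrite <- exp_plus; f_equal; ring).
    rewrite Rmult_assoc; apply Rmult_le_compat_l; [lra|].
    assert (H := exp_pos (e * v)); apply Rmult_le_compat; lra. }
assert (Hch : 0 < cosh (e * v) <= exp (2 * v)).
{ split; [apply cosh_pos|].
  eapply Rle_trans; [apply cosh_le_exp_Rabs|].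
  apply exp_le; rewrite Rabs_pos_eq; lra. }
assert (Hii : i * i <= 4 * exp (- (2 * PI * v))).
{ replace (exp (- (2 * PI * v))) with (exp (- (PI * v)) * exp (- (PI * v)))
    by (rewrite <- exp_plus; f_equal; ring).
  assert (H := exp_pos (- (PI * v))); nra. }
(* Uses only 2 [PI] - 2 >= 1, from [PI] > 3. *)
assert (Hexp : exp (- (2 * PI * v)) * exp (2 * v) <= exp (- 1 * v)).
{ rewrite <- exp_plus; apply exp_le; nra. }
assert (HE := exp_pos (2 * v)); assert (HE' := exp_pos (- (2 * PI * v))).
assert (Hiie : i * i * exp (2 * v) <= 4 * exp (- 1 * v)) by nra.
assert (T1 : Rabs (e ^ 2 * damp (PI - e) v) <= 2 * e ^ 2 * exp (- e * v)).
{ rewrite Rabs_pos_eq by (apply Rmult_le_pos; [apply pow2_ge_0 | lra]).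
  replace (2 * e ^ 2 * exp (- e * v)) with (e ^ 2 * (2 * exp (- e * v))) by ring.
  apply Rmult_le_compat_l; [apply pow2_ge_0 | lra]. }
assert (T2 : Rabs (2 * PI ^ 2 * sinh (PI * v) * sinh (e * v) / cosh (PI * v) ^ 3)
   <= 8 * PI ^ 2 * e * exp (- 1 * v)).
{ replace (2 * PI ^ 2 * sinh (PI * v) * sinh (e * v) / cosh (PI * v) ^ 3)
    with (2 * PI ^ 2 * (sinh (PI * v) * i) * (sinh (e * v) * (i * i)))
    by (unfold i; field; apply cosh_neq_0).
  assert (Ht : Rabs (sinh (PI * v) * i) <= 1).
  { rewrite Rabs_mult, (Rabs_pos_eq i) by lra.
    apply Rle_div_l; [exact Hc | lra]. }
  assert (H0 := Rabs_pos (sinh (PI * v) * i)).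
  assert (Hq : 0 <= sinh (e * v) * (i * i) <= 4 * e * exp (- 1 * v)).
  { split; [apply Rmult_le_pos; nra|].
    apply Rle_trans with (e * exp (2 * v) * (i * i)); [apply Rmult_le_compat_r; nra|].
    nra. }
  rewrite !Rabs_mult, (Rabs_pos_eq 2), (Rabs_pos_eq (PI ^ 2)) by (lra || apply pow2_ge_0).
  rewrite <- !Rabs_mult; rewrite (Rabs_pos_eq (sinh (e * v) * (i * i))) by lra.
  assert (HP := pow2_ge_0 PI).
  replace (8 * PI ^ 2 * e * exp (- 1 * v)) with (2 * PI ^ 2 * 1 * (4 * e * exp (- 1 * v))) by ring.
  apply Rmult_le_compat; [apply Rmult_le_pos; lra | lra | | lra].
  apply Rmult_le_compat_l; lra. }
assert (T3 : Rabs (2 * e * PI * cosh (e * v) / cosh (PI * v) ^ 2) <= 8 * PI * e * exp (- 1 * v)).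
{ replace (2 * e * PI * cosh (e * v) / cosh (PI * v) ^ 2)
    with (2 * e * PI * (cosh (e * v) * (i * i))) by (unfold i; field; apply cosh_neq_0).
  assert (Hq : 0 <= cosh (e * v) * (i * i) <= 4 * exp (- 1 * v)).
  { split; [apply Rmult_le_pos; nra|].
    apply Rle_trans with (exp (2 * v) * (i * i)); [apply Rmult_le_compat_r; nra|]; nra. }
  assert (0 <= 2 * e * PI) by nra.
  rewrite Rabs_pos_eq by (apply Rmult_le_pos; lra).
  replace (8 * PI * e * exp (- 1 * v)) with (2 * e * PI * (4 * exp (- 1 * v))) by ring.
  apply Rmult_le_compat_l; lra. }
unfold damp'', damp_const.
apply Rabs_le_between in T1; apply Rabs_le_between in T2; apply Rabs_le_between in T3.
apply Rabs_le; lra.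
Qed.

Lemma damp_const_pos : 0 < damp_const.
Proof. unfold damp_const; assert (H := PI_gt_3); nra. Qed.

(** * Integration by parts for the cosine integrals *)

Lemma continuous_cos_lin (u v : R) : continuous (fun v => cos (u * v)) v.
Proof. apply (ex_derive_continuous (V := R_NormedModule)); auto_derive; exact I. Qed.

Lemma continuous_cos_mult (f : R -> R) (u v : R) :
  continuous f v -> continuous (fun v => cos (u * v) * f v) v.
Proof. intros H; apply (continuous_mult (K := R_AbsRing)); [apply continuous_cos_lin | exact H]. Qed.

(** Both integrations by parts are done at once, through an explicit antiderivative [F] of cos (u v)
    ([damp] + [damp''] / u^2). Nothing is left at the lower end, because sin 0 = 0 and [damp']
    vanishes at 0. *)
Lemma RInt_cos_damp (e u A : R) :
  u <> 0 ->
  RInt (fun v => cos (u * v) * damp (PI - e) v) 0 A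
  = sin (u * A) / u * damp (PI - e) A + cos (u * A) / u ^ 2 * damp' e A
    - / u ^ 2 * RInt (fun v => cos (u * v) * damp'' e v) 0 A.
Proof.
intros Hu.
set (F := fun v => sin (u * v) / u * damp (PI - e) v + cos (u * v) / u ^ 2 * damp' e v).
assert (HF : RInt (fun v => cos (u * v) * damp (PI - e) v + / u ^ 2 * (cos (u * v) * damp'' e v)) 0 A = F A - F 0).
{ apply is_RInt_unique.
  apply (is_RInt_derive (V := R_CompleteNormedModule) F).
  - intros v _; unfold F.
    assert (D0 := is_derive_damp e v); assert (D1 := is_derive_damp' e v).
    auto_derive.
    + split; [eexists; exact D0 | split; [eexists; exact D1 | exact I]].
    + replace (Derive (fun x : R => damp (PI - e) x) v) with (damp' e v)
        by (symmetry; apply is_derive_unique, D0).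
      replace (Derive (fun x : R => damp' e x) v) with (damp'' e v)
        by (symmetry; apply is_derive_unique, D1).
      field; exact Hu.
  - intros v _; apply (continuous_plus (V := R_NormedModule)).
    + apply continuous_cos_mult, continuous_damp.
    + apply (continuous_scal_r (K := R_AbsRing) (V := R_NormedModule)).
      apply continuous_cos_mult, continuous_damp''. }
assert (H1 : forall v, continuous (fun v => cos (u * v) * damp (PI - e) v) v)
  by (intros v; apply continuous_cos_mult, continuous_damp).
assert (H2 : forall v, continuous (fun v => cos (u * v) * damp'' e v) v)
  by (intros v; apply continuous_cos_mult, continuous_damp'').
assert (HR : RInt (fun v => cos (u * v) * damp (PI - e) v + / u ^ 2 * (cos (u * v) * damp'' e v)) 0 A
  = RInt (fun v => cos (u * v) * damp (PI - e) v) 0 A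
    + / u ^ 2 * RInt (fun v => cos (u * v) * damp'' e v) 0 A).
{ apply is_RInt_unique.
  apply (is_RInt_plus (V := R_NormedModule) (fun v => cos (u * v) * damp (PI - e) v)
    (fun v => / u ^ 2 * (cos (u * v) * damp'' e v))).
  - apply (RInt_correct (V := R_CompleteNormedModule)), ex_RInt_cont, H1.
  - apply (is_RInt_scal (V := R_NormedModule) (fun v => cos (u * v) * damp'' e v)).
    apply (RInt_correct (V := R_CompleteNormedModule)), ex_RInt_cont, H2. }
rewrite HR in HF.
assert (HF0 : F 0 = 0) by (unfold F; rewrite damp'_0, Rmult_0_r, sin_0; field; exact Hu).
rewrite HF0 in HF; unfold F in HF; lra.
Qed.

Definition damp''_major (e v : R) : R := 2 * e ^ 2 * exp (- e * v) + e * damp_const * exp (- 1 * v).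

Lemma continuous_damp''_major (e v : R) : continuous (damp''_major e) v.
Proof. apply (ex_derive_continuous (V := R_NormedModule)); unfold damp''_major; auto_derive; exact I. Qed.

(** The first exponential has mass 1 / e, which costs one of the two factors e in front of it; both
    parts are then of order e. *)
Lemma RInt_damp''_major_le (e A : R) :
  0 < e <= 1 -> 0 <= A -> RInt (damp''_major e) 0 A <= e * (2 + damp_const).
Proof.
intros He HA.
assert (E : RInt (damp''_major e) 0 A =
  (- 2 * e * exp (- e * A) - e * damp_const * exp (- 1 * A))
  - (- 2 * e * exp (- e * 0) - e * damp_const * exp (- 1 * 0))).
{ apply is_RInt_unique.
  apply (is_RInt_derive (V := R_CompleteNormedModule)
    (fun v => - 2 * e * exp (- e * v) - e * damp_const * exp (- 1 * v))).
  - intros v _; unfold damp''_major; auto_derive; [exact I | ring].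
  - intros v _; apply continuous_damp''_major. }
rewrite E, !Rmult_0_r, exp_0.
assert (H1 := exp_pos (- e * A)); assert (H2 := exp_pos (- 1 * A)); assert (H3 := damp_const_pos).
assert (0 <= e * damp_const) by nra; nra.
Qed.

(** The weight v turns the mass 1 / e into a first moment 1 / e^2, consuming both factors e. The
    result is uniform in e without being small, which is enough for a Lipschitz bound in the
    frequency. *)
Lemma RInt_id_damp''_major_le (e A : R) :
  0 < e <= 1 -> 0 <= A -> RInt (fun v => v * damp''_major e v) 0 A <= 2 + damp_const.
Proof.
intros He HA.
assert (E : RInt (fun v => v * damp''_major e v) 0 A =
  (- 2 * (1 + e * A) * exp (- e * A) - e * damp_const * (1 + A) * exp (- 1 * A))
  - (- 2 * (1 + e * 0) * exp (- e * 0) - e * damp_const * (1 + 0) * exp (- 1 * 0))).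
{ apply is_RInt_unique.
  apply (is_RInt_derive (V := R_CompleteNormedModule)
    (fun v => - 2 * (1 + e * v) * exp (- e * v) - e * damp_const * (1 + v) * exp (- 1 * v))).
  - intros v _; unfold damp''_major; auto_derive; [exact I | ring].
  - intros v _; apply (ex_derive_continuous (V := R_NormedModule)); unfold damp''_major; auto_derive; exact I. }
rewrite E, !Rmult_0_r, exp_0.
assert (H1 := exp_pos (- e * A)); assert (H2 := exp_pos (- 1 * A)); assert (H3 := damp_const_pos).
assert (0 <= e * damp_const <= damp_const) by nra.
assert (0 <= e * A) by nra.
assert (0 <= e * damp_const * (1 + A) * exp (- 1 * A))
  by (apply Rmult_le_pos; [apply Rmult_le_pos; lra | lra]).
nra.
Qed.

Lemma RInt_cos_damp''_le (e u A : R) :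
  0 < e <= 1 -> 0 <= A ->
  Rabs (RInt (fun v => cos (u * v) * damp'' e v) 0 A) <= e * (2 + damp_const).
Proof.
intros He HA; eapply Rle_trans; [|apply RInt_damp''_major_le; eassumption].
apply RInt_Rabs_le; [exact HA | | intros v; apply continuous_damp''_major |].
- intros v; apply continuous_cos_mult, continuous_damp''.
- intros v Hv; rewrite Rabs_mult, <- (Rmult_1_l (damp''_major e v)).
  apply Rmult_le_compat; try apply Rabs_pos; [apply Rabs_le, COS_bound|].
  apply damp''_bound; lra.
Qed.

Lemma RInt_cos_damp''_lipschitz (e u u' A : R) :
  0 < e <= 1 -> 0 <= A ->
  Rabs (RInt (fun v => cos (u * v) * damp'' e v) 0 A - RInt (fun v => cos (u' * v) * damp'' e v) 0 A)
  <= (2 + damp_const) * Rabs (u - u').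
Proof.
intros He HA.
assert (Hc : forall w v, continuous (fun v => cos (w * v) * damp'' e v) v)
  by (intros w v; apply continuous_cos_mult, continuous_damp'').
assert (HM : forall v, continuous (fun v => v * damp''_major e v) v).
{ intros v; apply (continuous_mult (K := R_AbsRing)); [apply continuous_id | apply continuous_damp''_major]. }
assert (E := RInt_minus (V := R_CompleteNormedModule) _ _ 0 A
  (ex_RInt_cont _ 0 A (Hc u)) (ex_RInt_cont _ 0 A (Hc u'))).
unfold minus, plus, opp in E; simpl in E; unfold Rminus at 1; rewrite <- E.
apply Rle_trans with (RInt (fun v => Rabs (u - u') * (v * damp''_major e v)) 0 A).
- apply RInt_Rabs_le; [exact HA | | |].
  + intros v; apply (continuous_minus (V := R_NormedModule)); apply Hc.
  + intros v; apply (continuous_scal_r (K := R_AbsRing) (V := R_NormedModule)), HM.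
  + intros v Hv.
    replace (cos (u * v) * damp'' e v + - (cos (u' * v) * damp'' e v))
      with ((cos (u * v) - cos (u' * v)) * damp'' e v) by ring.
    rewrite Rabs_mult, <- Rmult_assoc.
    apply Rmult_le_compat; try apply Rabs_pos; [|apply damp''_bound; lra].
    eapply Rle_trans; [apply cos_lipschitz|].
    replace (u * v - u' * v) with ((u - u') * v) by ring.
    rewrite Rabs_mult, (Rabs_pos_eq v) by lra; apply Rle_refl.
- rewrite (RInt_scal (V := R_CompleteNormedModule) (fun v => v * damp''_major e v)) by apply ex_RInt_cont, HM.
  unfold scal; simpl; unfold mult; simpl; rewrite Rmult_comm.
  apply Rmult_le_compat_r; [apply Rabs_pos | apply RInt_id_damp''_major_le; assumption].
Qed.

(** * The cosine transform of the damping factor *)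

Definition kernel (phi u : R) : R :=
  real (Lim (fun A => RInt (fun v => cos (u * v) * damp phi v) 0 A) p_infty).

Lemma continuous_kernel_integrand (phi u v : R) : continuous (fun v => cos (u * v) * damp phi v) v.
Proof. apply continuous_cos_mult, continuous_damp. Qed.

Lemma cos_damp_bound (phi u v : R) :
  0 <= v -> Rabs (cos (u * v) * damp phi v) <= 2 * exp (- (PI - Rabs phi) * v).
Proof.
intros Hv; assert (H := damp_bound phi v Hv).
rewrite Rabs_mult, (Rabs_pos_eq (damp _ _)) by lra.
rewrite <- (Rmult_1_l (2 * _)).
apply Rmult_le_compat; [apply Rabs_pos | lra | apply Rabs_le, COS_bound | lra].
Qed.

(** This gives the total expression [kernel] its meaning: for |phi| < [PI] the limit inside it
    exists and is finite. *)
Lemma improper_kernel (phi u : R) :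
  Rabs phi < PI -> improper (fun v => cos (u * v) * damp phi v) (kernel phi u).
Proof.
intros Hphi.
destruct (improper_exists (fun v => cos (u * v) * damp phi v) 2 (PI - Rabs phi)) as [l Hl].
- lra.
- intros v; apply continuous_kernel_integrand.
- intros v; apply cos_damp_bound.
- unfold kernel; rewrite (is_lim_unique _ _ _ Hl); exact Hl.
Qed.

Lemma is_lim_boundary (e u : R) :
  u <> 0 -> 0 < e <= PI ->
  is_lim (fun A => sin (u * A) / u * damp (PI - e) A + cos (u * A) / u ^ 2 * damp' e A) p_infty 0.
Proof.
intros Hu He.
set (C := / Rabs u * 2 + / u ^ 2 * (4 * PI)).
apply is_lim_p_infty_eps; intros eps Heps.
destruct (proj1 (is_lim_p_infty_eps _ _) (is_lim_exp_decay C e (proj1 He)) eps Heps) as [M HM].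
exists (Rmax M 0); intros A HA.
assert (Hm1 := Rmax_l M 0); assert (Hm2 := Rmax_r M 0).
specialize (HM A ltac:(lra)); rewrite Rminus_0_r in HM |- *.
eapply Rle_lt_trans; [|eapply Rle_lt_trans; [apply Rle_abs | exact HM]].
assert (Hd := damp_bound (PI - e) A ltac:(lra)); rewrite (Rabs_pos_eq (PI - e)) in Hd by lra.
replace (- (PI - (PI - e)) * A) with (- e * A) in Hd by ring.
assert (Hd' := damp'_bound e A ltac:(lra) ltac:(lra)).
assert (Hu1 : 0 < / Rabs u) by (apply Rinv_0_lt_compat, Rabs_pos_lt, Hu).
assert (Hu2 : 0 < / u ^ 2) by (apply Rinv_0_lt_compat; assert (H := pow2_gt_0 u Hu); lra).
assert (Hs : Rabs (sin (u * A)) <= 1) by (apply Rabs_le, SIN_bound).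
assert (Hc : Rabs (cos (u * A)) <= 1) by (apply Rabs_le, COS_bound).
assert (Hs0 := Rabs_pos (sin (u * A))); assert (Hc0 := Rabs_pos (cos (u * A))).
eapply Rle_trans; [apply Rabs_triang|]; unfold Rdiv; rewrite !Rabs_mult.
rewrite Rabs_inv, (Rabs_pos_eq (/ u ^ 2)), (Rabs_pos_eq (damp _ _)) by lra.
unfold C; rewrite Rmult_plus_distr_r; apply Rplus_le_compat; rewrite Rmult_assoc.
- rewrite <- (Rmult_1_l (/ Rabs u * 2 * _)).
  apply Rmult_le_compat; [lra | apply Rmult_le_pos; lra | lra |].
  rewrite Rmult_assoc; apply Rmult_le_compat_l; lra.
- rewrite <- (Rmult_1_l (/ u ^ 2 * (4 * PI) * _)).
  apply Rmult_le_compat; [lra | apply Rmult_le_pos; [lra | apply Rabs_pos] | lra |].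
  rewrite Rmult_assoc; apply Rmult_le_compat_l; lra.
Qed.

(* The boundary terms of the double integration by parts vanish at infinity. *)
Lemma is_lim_kernel (e u : R) :
  u <> 0 -> 0 < e <= 1 ->
  is_lim (fun A => - / u ^ 2 * RInt (fun v => cos (u * v) * damp'' e v) 0 A) p_infty (kernel (PI - e) u).
Proof.
intros Hu He; assert (HPI := PI_gt_3).
assert (Hk := improper_kernel (PI - e) u ltac:(rewrite Rabs_pos_eq; lra)).
assert (Hb := is_lim_boundary e u Hu ltac:(lra)).
replace (kernel (PI - e) u) with (kernel (PI - e) u - 0) by ring.
eapply is_lim_ext; [|apply (is_lim_minus' _ _ _ _ _ Hk Hb)].
intros A; cbv beta; rewrite (RInt_cos_damp e u A Hu); ring.
Qed.

(** At u = 0 no such bound can hold: the kernel there is the integral of the damping factor, which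
    grows like 1 / e. *)
Lemma kernel_le (e u : R) :
  u <> 0 -> 0 < e <= 1 -> Rabs (kernel (PI - e) u) <= / u ^ 2 * (e * (2 + damp_const)).
Proof.
intros Hu He.
apply (is_lim_Rabs_le _ _ _ 0 (is_lim_kernel e u Hu He)); intros A HA.
assert (Hu2 : 0 < / u ^ 2) by (apply Rinv_0_lt_compat; assert (H := pow2_gt_0 u Hu); lra).
rewrite Rabs_mult, Rabs_Ropp, (Rabs_pos_eq (/ u ^ 2)) by lra.
apply Rmult_le_compat_l; [lra | apply RInt_cos_damp''_le; lra].
Qed.

Lemma inv_sq_lipschitz (u w : R) :
  1 <= Rabs u -> 1 <= Rabs w -> Rabs (/ u ^ 2 - / w ^ 2) <= 2 * Rabs (u - w).
Proof.
intros Hu Hw.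
assert (Hu0 : u <> 0) by (intros ->; rewrite Rabs_R0 in Hu; lra).
assert (Hw0 : w <> 0) by (intros ->; rewrite Rabs_R0 in Hw; lra).
replace (/ u ^ 2 - / w ^ 2) with ((w - u) * (/ u * / w) * (/ u + / w)) by (field; split; assumption).
assert (Hi : Rabs (/ u) <= 1) by (rewrite Rabs_inv; rewrite <- Rinv_1; apply Rinv_le_contravar; lra).
assert (Hj : Rabs (/ w) <= 1) by (rewrite Rabs_inv; rewrite <- Rinv_1; apply Rinv_le_contravar; lra).
assert (H1 := Rabs_pos (/ u)); assert (H2 := Rabs_pos (/ w)).
rewrite !Rabs_mult, (Rabs_minus_sym w), Rmult_assoc, Rmult_comm.
apply Rmult_le_compat_r; [apply Rabs_pos|].
assert (H3 := Rabs_triang (/ u) (/ w)); assert (H4 := Rabs_pos (/ u + / w)).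
assert (Rabs (/ u) * Rabs (/ w) <= 1) by nra.
assert (0 <= Rabs (/ u) * Rabs (/ w)) by nra.
nra.
Qed.

(** The kernel is - u^(-2) times a limit of integrals. Varying the integral costs 2 + [damp_const],
    varying u^(-2) costs twice that amount, hence the factor 3; |u| >= 1 controls u^(-2) and its
    variation. *)
Lemma kernel_lipschitz (e u w : R) :
  1 <= Rabs u -> 1 <= Rabs w -> 0 < e <= 1 ->
  Rabs (kernel (PI - e) u - kernel (PI - e) w) <= 3 * (2 + damp_const) * Rabs (u - w).
Proof.
intros Hu Hw He.
assert (Hu0 : u <> 0) by (intros ->; rewrite Rabs_R0 in Hu; lra).
assert (Hw0 : w <> 0) by (intros ->; rewrite Rabs_R0 in Hw; lra).
assert (HB := damp_const_pos).
apply (is_lim_Rabs_le _ _ _ 0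
  (is_lim_minus' _ _ _ _ _ (is_lim_kernel e u Hu0 He) (is_lim_kernel e w Hw0 He))).
intros A HA.
set (Qu := RInt (fun v => cos (u * v) * damp'' e v) 0 A).
set (Qw := RInt (fun v => cos (w * v) * damp'' e v) 0 A).
assert (H1 : Rabs (Qu - Qw) <= (2 + damp_const) * Rabs (u - w)) by (apply RInt_cos_damp''_lipschitz; lra).
assert (H2 : Rabs Qw <= e * (2 + damp_const)) by (apply RInt_cos_damp''_le; lra).
assert (H3 := inv_sq_lipschitz u w Hu Hw).
assert (H4 : Rabs (/ u ^ 2) <= 1).
{ rewrite Rabs_inv, <- RPow_abs, <- Rinv_1; apply Rinv_le_contravar; nra. }
replace (- / u ^ 2 * Qu - - / w ^ 2 * Qw) with (- (/ u ^ 2 * (Qu - Qw)) - (/ u ^ 2 - / w ^ 2) * Qw) by ring.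
unfold Rminus at 1; eapply Rle_trans; [apply Rabs_triang|]; rewrite !Rabs_Ropp, !Rabs_mult.
assert (H5 := Rabs_pos (u - w)); assert (H6 := Rabs_pos (Qu - Qw)); assert (H7 := Rabs_pos Qw).
assert (H8 := Rabs_pos (/ u ^ 2)); assert (H9 := Rabs_pos (/ u ^ 2 - / w ^ 2)).
assert (G1 : Rabs (/ u ^ 2) * Rabs (Qu - Qw) <= 1 * ((2 + damp_const) * Rabs (u - w)))
  by (apply Rmult_le_compat; lra).
assert (G2 : Rabs (/ u ^ 2 - / w ^ 2) * Rabs Qw <= 2 * Rabs (u - w) * (2 + damp_const))
  by (apply Rmult_le_compat; nra).
lra.
Qed.

(** * Termwise integration *)

Lemma filterlim_plus_0 {U : Type} {F : (U -> Prop) -> Prop} {FF : Filter F} (f g : U -> R) :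
  filterlim f F (locally 0) -> filterlim g F (locally 0) ->
  filterlim (fun x => f x + g x) F (locally 0).
Proof.
intros Hf Hg.
assert (H := filterlim_plus (V := R_NormedModule) 0 0).
unfold plus in H at 2; simpl in H; rewrite Rplus_0_l in H.
exact (filterlim_comp_2 _ _ _ Hf Hg H).
Qed.

Lemma filterlim_scal_0 {U : Type} {F : (U -> Prop) -> Prop} {FF : Filter F} (c : R) (f : U -> R) :
  filterlim f F (locally 0) -> filterlim (fun x => c * f x) F (locally 0).
Proof.
intros Hf.
assert (H := filterlim_scal_r (K := R_AbsRing) (V := R_NormedModule) c 0).
unfold scal in H at 2; simpl in H; unfold mult in H; simpl in H; rewrite Rmult_0_r in H.
exact (filterlim_comp _ _ _ _ _ _ _ _ Hf H).
Qed.

Lemma filterlim_sum_n_0 {U : Type} {F : (U -> Prop) -> Prop} {FF : Filter F} (T : U -> nat -> R) (N : nat) :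
  (forall n, filterlim (fun x => T x n) F (locally 0)) ->
  filterlim (fun x => sum_n (T x) N) F (locally 0).
Proof.
intros H; induction N as [|N IH].
- apply filterlim_ext with (2 := H 0%nat); intros x; rewrite sum_O; reflexivity.
- apply filterlim_ext with (fun x => sum_n (T x) N + T x (S N)).
  + intros x; rewrite sum_Sn; reflexivity.
  + apply filterlim_plus_0; [exact IH | apply H].
Qed.

(** Tannery's theorem along a filter with limit 0. The first [N] terms tend to 0 one by one; the
    tail is under that of [m], domination being asked only from [N0] on. *)
Lemma tannery_0 {U : Type} {F : (U -> Prop) -> Prop} {FF : Filter F} (T : U -> nat -> R) (m : nat -> R) (J : U -> R) (N0 : nat) :
  (forall n, filterlim (fun x => T x n) F (locally 0)) ->
  F (fun x => forall n, (N0 <= n)%nat -> Rabs (T x n) <= m n) ->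
  ex_series m ->
  F (fun x => is_series (T x) (J x)) ->
  filterlim J F (locally 0).
Proof.
intros HT Hm Hex HJ.
apply filterlim_locally; intros eps.
assert (Heps := cond_pos eps).
assert (Hs : is_lim_seq (sum_n m) (Series m)) by (apply Series_correct, Hex).
destruct (is_lim_seq_eps_inv _ _ Hs (eps / 2) ltac:(lra)) as [N1 HN1].
set (N := Nat.max N0 N1).
specialize (HN1 N (Nat.le_max_r _ _)); apply Rabs_def2 in HN1.
assert (Hsum := proj1 (filterlim_locally _ _) (filterlim_sum_n_0 T N HT) (mkposreal (eps / 2) ltac:(lra))).
generalize (filter_and _ _ Hsum (filter_and _ _ Hm HJ)); apply filter_imp.
intros x (H1 & H2 & H3).
change (Rabs (sum_n (T x) N - 0) < eps / 2) in H1; change (Rabs (J x - 0) < eps).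
rewrite Rminus_0_r in H1 |- *.
assert (H4 : Rabs (Series (T x) - sum_n (T x) N) <= Series m - sum_n m N).
{ apply Series_tail_le; [|exists (J x); exact H3 | exact Hex].
  intros n Hn; apply H2; assert (H := Nat.le_max_l N0 N1); fold N in H; lia. }
rewrite (is_series_unique _ _ H3) in H4.
apply Rabs_def2 in H1; apply Rabs_le_between in H4; apply Rabs_def1; lra.
Qed.

(* [twisted_eta rho v] is the real part of [rho^(iv) (1 - 2^(1-s)) zeta(s)] at [s = 1/2 + iv]. *)
Definition twisted_eta (rho v : R) : R := eta (wave (v * ln rho) v) (1 / 2).

(** A locally uniform limit of continuous functions. The approximations of [twisted_eta] have an
    error growing with |v|, so they are uniform on bounded sets only. *)
Lemma continuous_locally_approx (f : R -> R) (x : R) :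
  (forall eps, 0 < eps -> exists g, continuous g x /\ locally x (fun y => Rabs (f y - g y) <= eps)) ->
  continuous f x.
Proof.
intros H; apply filterlim_locally; intros eps; assert (Heps := cond_pos eps).
destruct (H (eps / 4) ltac:(lra)) as (g & Hg & Hfg).
assert (Hg' := proj1 (filterlim_locally _ _) Hg (mkposreal (eps / 4) ltac:(lra))).
assert (Hx := locally_singleton _ _ Hfg).
generalize (filter_and _ _ Hfg Hg'); apply filter_imp.
intros y (H1 & H2).
change (Rabs (g y - g x) < eps / 4) in H2; change (Rabs (f y - f x) < eps).
apply Rabs_le_between in H1; apply Rabs_le_between in Hx; apply Rabs_def2 in H2; apply Rabs_def1; lra.
Qed.

Definition wave_term (rho v : R) (n : nat) : R := alt_term (wave (v * ln rho) v) (1 / 2) n.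

Lemma wave_term_eq (rho v : R) (n : nat) :
  wave_term rho v n =
  (-1) ^ n * decay (1 / 2) n * cos ((ln rho - log_nat n) * v)
  + - ((-1) ^ n * decay (1 / 2) (S n)) * cos ((ln rho - log_nat (S n)) * v).
Proof.
unfold wave_term, alt_term, dir_term, wave.
replace (v * ln rho - v * log_nat n) with ((ln rho - log_nat n) * v) by ring.
replace (v * ln rho - v * log_nat (S n)) with ((ln rho - log_nat (S n)) * v) by ring.
ring.
Qed.

Lemma continuous_wave_term (rho v : R) (n : nat) : continuous (fun v => wave_term rho v n) v.
Proof.
apply (continuous_ext (fun v => (-1) ^ n * decay (1 / 2) n * cos ((ln rho - log_nat n) * v)
  + - ((-1) ^ n * decay (1 / 2) (S n)) * cos ((ln rho - log_nat (S n)) * v))).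
- intros w; symmetry; apply wave_term_eq.
- apply (ex_derive_continuous (V := R_NormedModule)); auto_derive; exact I.
Qed.

Definition eta_partial (rho : R) (N : nat) (v : R) : R :=
  / 2 * cos (ln rho * v) + / 2 * sum_n (wave_term rho v) N.

Lemma continuous_sum_wave_term (rho v : R) (N : nat) : continuous (fun v => sum_n (wave_term rho v) N) v.
Proof.
induction N as [|N IH].
- apply (continuous_ext (fun v => wave_term rho v 0)).
  + intros w; symmetry; apply sum_O.
  + apply continuous_wave_term.
- apply (continuous_ext (fun v => sum_n (wave_term rho v) N + wave_term rho v (S N))).
  + intros w; rewrite sum_Sn; reflexivity.
  + apply (continuous_plus (V := R_NormedModule)); [exact IH | apply continuous_wave_term].
Qed.

Lemma continuous_eta_partial (rho v : R) (N : nat) : continuous (eta_partial rho N) v.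
Proof.
apply (continuous_plus (V := R_NormedModule));
  apply (continuous_scal_r (K := R_AbsRing) (V := R_NormedModule)).
- apply continuous_cos_lin.
- apply continuous_sum_wave_term.
Qed.

(** In the tail bound e^t / t at t = 1/2 is 2 e^(1/2); the 2 cancels against the division by 2 in
    [eta]. *)
Definition tail_const : R := exp (1 / 2).

Lemma eta_partial_approx (rho v : R) (N : nat) :
  Rabs (twisted_eta rho v - eta_partial rho N v) <= (1 / 2 + Rabs v) * tail_const * decay (1 / 2) (S N).
Proof.
assert (H := alt_term_tail _ _ (1 / 2) N (bounded_lipschitz_wave (v * ln rho) v) ltac:(lra)).
unfold twisted_eta, eta, eta_partial, tail_const.
replace (dir_term (wave (v * ln rho) v) (1 / 2) 0) with (cos (ln rho * v)).
2:{ unfold dir_term, wave; rewrite log_nat_0, decay_0.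
    replace (v * ln rho - v * 0) with (ln rho * v) by ring; ring. }
change (sum_n (wave_term rho v) N) with (sum_n (alt_term (wave (v * ln rho) v) (1 / 2)) N).
replace ((cos (ln rho * v) + Series (alt_term (wave (v * ln rho) v) (1 / 2))) / 2
   - (/ 2 * cos (ln rho * v) + / 2 * sum_n (alt_term (wave (v * ln rho) v) (1 / 2)) N))
  with (/ 2 * (Series (alt_term (wave (v * ln rho) v) (1 / 2)) - sum_n (alt_term (wave (v * ln rho) v) (1 / 2)) N))
  by field.
rewrite Rabs_mult, (Rabs_pos_eq (/ 2)) by lra; lra.
Qed.

Lemma continuous_twisted_eta (rho v : R) : continuous (twisted_eta rho) v.
Proof.
apply continuous_locally_approx; intros eps Heps.
set (C := (1 / 2 + (Rabs v + 1)) * tail_const).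
assert (HC : 0 < C).
{ assert (H0 := Rabs_pos v); assert (H1 := exp_pos (1 / 2)); unfold C, tail_const.
  apply Rmult_lt_0_compat; lra. }
destruct (is_lim_seq_eps_inv _ _ (is_lim_seq_decay (1 / 2) ltac:(lra)) (eps / C)) as [N HN].
{ apply Rdiv_lt_0_compat; lra. }
exists (eta_partial rho N); split; [apply continuous_eta_partial|].
exists (mkposreal 1 Rlt_0_1); intros y Hy.
change (Rabs (y - v) < 1) in Hy.
specialize (HN (S N) ltac:(lia)); rewrite Rminus_0_r in HN.
assert (Hd := decay_pos (1 / 2) (S N)); rewrite Rabs_pos_eq in HN by lra.
eapply Rle_trans; [apply eta_partial_approx|].
apply Rle_trans with (C * decay (1 / 2) (S N)).
- apply Rmult_le_compat_r; [lra|]; apply Rmult_le_compat_r; [left; apply exp_pos|].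
  replace y with (v + (y - v)) by ring; assert (H := Rabs_triang v (y - v)); lra.
- apply Rlt_div_r in HN; [lra | exact HC].
Qed.

Lemma twisted_eta_growth (rho v : R) :
  Rabs (twisted_eta rho v) <= 2 + (1 / 2 + Rabs v) * tail_const.
Proof.
assert (H := eta_partial_approx rho v 0).
assert (Hp : Rabs (eta_partial rho 0 v) <= 2).
{ unfold eta_partial; rewrite sum_O, wave_term_eq, decay_0; simpl pow.
  assert (H1 := COS_bound (ln rho * v)).
  assert (H2 := COS_bound ((ln rho - log_nat 0) * v)).
  assert (H3 : Rabs (decay (1 / 2) 1 * cos ((ln rho - log_nat 1) * v)) <= 1).
  { rewrite Rabs_mult, (Rabs_pos_eq (decay _ _)) by (left; apply decay_pos).
    assert (G1 := decay_decr (1 / 2) 0 ltac:(lra)); rewrite decay_0 in G1.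
    assert (G2 := decay_pos (1 / 2) 1).
    assert (G3 : Rabs (cos ((ln rho - log_nat 1) * v)) <= 1) by (apply Rabs_le, COS_bound).
    assert (G4 := Rabs_pos (cos ((ln rho - log_nat 1) * v))); nra. }
  apply Rabs_le_between in H3; apply Rabs_le; lra. }
assert (Hd := decay_decr (1 / 2) 0 ltac:(lra)); rewrite decay_0 in Hd.
assert (Hd0 := decay_pos (1 / 2) 1).
assert (H2 : (1 / 2 + Rabs v) * tail_const * decay (1 / 2) 1 <= (1 / 2 + Rabs v) * tail_const).
{ rewrite <- (Rmult_1_r ((1 / 2 + Rabs v) * tail_const)) at 2; apply Rmult_le_compat_l; [|exact Hd].
  assert (G := Rabs_pos v); apply Rmult_le_pos; [lra | left; apply exp_pos]. }
replace (twisted_eta rho v) with ((twisted_eta rho v - eta_partial rho 0 v) + eta_partial rho 0 v) by ring.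
eapply Rle_trans; [apply Rabs_triang|]; lra.
Qed.

(** Half of the exponential rate is spent on the linear factor: with d = [PI] - |phi|, v e^(- d v /
    2) <= 2 / d. *)
Lemma linear_damp_bound (a b phi v : R) :
  0 <= a -> 0 <= b -> Rabs phi < PI -> 0 <= v ->
  (a + b * v) * damp phi v <= (2 * a + 4 * b / (PI - Rabs phi)) * exp (- ((PI - Rabs phi) / 2) * v).
Proof.
intros Ha Hb Hphi Hv.
assert (Hd := damp_bound phi v Hv).
set (d := PI - Rabs phi) in *.
assert (Hd0 : 0 < d) by (unfold d; lra).
assert (E : exp (- d * v) = exp (- (d / 2) * v) * exp (- (d / 2) * v))
  by (rewrite <- exp_plus; f_equal; field).
set (x := exp (- (d / 2) * v)) in *.
assert (Hx : 0 < x) by apply exp_pos.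
assert (Hx1 : x <= 1) by (rewrite <- exp_0; apply exp_le; nra).
assert (Hvx : v * x <= 2 / d).
{ assert (H := exp_ge_1_plus (d / 2 * v)).
  assert (E2 : exp (d / 2 * v) * x = 1)
    by (unfold x; rewrite <- exp_plus, <- exp_0; f_equal; field).
  apply (proj1 (Rle_div_r _ _ d Hd0)); nra. }
apply Rle_trans with ((a + b * v) * (2 * (x * x))).
- apply Rmult_le_compat_l; [|lra].
  assert (0 <= b * v) by (apply Rmult_le_pos; assumption); lra.
- replace ((2 * a + 4 * b / d) * x) with ((2 * a + 2 * b * (2 / d)) * x) by (field; lra).
  replace ((a + b * v) * (2 * (x * x))) with ((2 * (a * x) + 2 * b * (v * x)) * x) by ring.
  apply Rmult_le_compat_r; [lra|].
  assert (a * x <= a) by nra.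
  assert (b * (v * x) <= b * (2 / d)) by (apply Rmult_le_compat_l; assumption).
  lra.
Qed.

Lemma continuous_twisted_damp (rho phi v : R) : continuous (fun v => twisted_eta rho v * damp phi v) v.
Proof. apply (continuous_mult (K := R_AbsRing)); [apply continuous_twisted_eta | apply continuous_damp]. Qed.

Definition twisted_integral (rho phi : R) : R :=
  real (Lim (fun A => RInt (fun v => twisted_eta rho v * damp phi v) 0 A) p_infty).

Lemma improper_twisted (rho phi : R) :
  Rabs phi < PI -> improper (fun v => twisted_eta rho v * damp phi v) (twisted_integral rho phi).
Proof.
intros Hphi.
set (a := 2 + 1 / 2 * tail_const).
assert (Htc : 0 < tail_const) by apply exp_pos.
destruct (improper_exists (fun v => twisted_eta rho v * damp phi v)
   (2 * a + 4 * tail_const / (PI - Rabs phi)) ((PI - Rabs phi) / 2)) as [l Hl].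
- lra.
- intros v; apply continuous_twisted_damp.
- intros v Hv.
  eapply Rle_trans; [|apply linear_damp_bound; unfold a; lra].
  assert (Hd := damp_bound phi v Hv).
  rewrite Rabs_mult, (Rabs_pos_eq (damp _ _)) by lra.
  apply Rmult_le_compat_r; [lra|].
  assert (H := twisted_eta_growth rho v); rewrite (Rabs_pos_eq v) in H by lra; unfold a; lra.
- unfold twisted_integral; rewrite (is_lim_unique _ _ _ Hl); exact Hl.
Qed.

Definition kernel_term (rho phi : R) (n : nat) : R :=
  (-1) ^ n * decay (1 / 2) n * kernel phi (ln rho - log_nat n)
  + - ((-1) ^ n * decay (1 / 2) (S n)) * kernel phi (ln rho - log_nat (S n)).

Lemma improper_wave_term (rho phi : R) (n : nat) :
  Rabs phi < PI -> improper (fun v => wave_term rho v n * damp phi v) (kernel_term rho phi n).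
Proof.
intros Hphi.
eapply improper_ext; [|unfold kernel_term; apply improper_plus;
  [| | apply improper_scal; [|apply improper_kernel, Hphi] | apply improper_scal; [|apply improper_kernel, Hphi]]].
- intros v _; simpl; rewrite wave_term_eq; ring.
- intros v; apply (continuous_scal_r (K := R_AbsRing) (V := R_NormedModule)), continuous_kernel_integrand.
- intros v; apply (continuous_scal_r (K := R_AbsRing) (V := R_NormedModule)), continuous_kernel_integrand.
- intros v; apply continuous_kernel_integrand.
- intros v; apply continuous_kernel_integrand.
Qed.

Lemma improper_sum_wave_term (rho phi : R) (N : nat) :
  Rabs phi < PI ->
  improper (fun v => sum_n (wave_term rho v) N * damp phi v) (sum_n (kernel_term rho phi) N).
Proof.
intros Hphi; induction N as [|N IH].
- rewrite sum_O; apply improper_ext with (2 := improper_wave_term rho phi 0 Hphi).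
  intros v _; rewrite sum_O; reflexivity.
- rewrite sum_Sn.
  apply improper_ext with (fun v => sum_n (wave_term rho v) N * damp phi v + wave_term rho v (S N) * damp phi v).
  + intros v _; rewrite sum_Sn; unfold plus; simpl; ring.
  + apply improper_plus; [| | exact IH | apply improper_wave_term, Hphi].
    * intros v; apply (continuous_mult (K := R_AbsRing)); [apply continuous_sum_wave_term | apply continuous_damp].
    * intros v; apply (continuous_mult (K := R_AbsRing)); [apply continuous_wave_term | apply continuous_damp].
Qed.

Lemma improper_eta_partial (rho phi : R) (N : nat) :
  Rabs phi < PI ->
  improper (fun v => eta_partial rho N v * damp phi v)
    (/ 2 * kernel phi (ln rho) + / 2 * sum_n (kernel_term rho phi) N).
Proof.
intros Hphi.
eapply improper_ext; [|apply improper_plus; [| | apply improper_scal; [|apply improper_kernel, Hphi]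
  | apply improper_scal; [|apply improper_sum_wave_term, Hphi]]].
- intros v _; simpl; unfold eta_partial; ring.
- intros v; apply (continuous_scal_r (K := R_AbsRing) (V := R_NormedModule)), continuous_kernel_integrand.
- intros v; apply (continuous_scal_r (K := R_AbsRing) (V := R_NormedModule)).
  apply (continuous_mult (K := R_AbsRing)); [apply continuous_sum_wave_term | apply continuous_damp].
- intros v; apply continuous_kernel_integrand.
- intros v; apply (continuous_mult (K := R_AbsRing)); [apply continuous_sum_wave_term | apply continuous_damp].
Qed.

(** The remainder of the averaged series, linear in |v|, is integrated against the damping factor
    and still tends to 0 with [decay (1 / 2)]. The constant [B] blows up as |phi| tends to [PI], so
    this identifies the sum for each fixed [phi] only. The value reflects that [eta] is half of the
    first term plus half of the averaged series. *)
Lemma is_series_kernel_term (rho phi : R) :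
  Rabs phi < PI ->
  is_series (kernel_term rho phi) (2 * twisted_integral rho phi - kernel phi (ln rho)).
Proof.
intros Hphi.
set (d := PI - Rabs phi).
assert (Hd : 0 < d) by (unfold d; lra).
assert (Htc : 0 < tail_const) by apply exp_pos.
set (C := 2 * (1 / 2) + 4 * 1 / d).
set (B := C / (d / 2)).
assert (Happ : forall N, Rabs (twisted_integral rho phi
    - (/ 2 * kernel phi (ln rho) + / 2 * sum_n (kernel_term rho phi) N))
    <= tail_const * B * decay (1 / 2) (S N)).
{ intros N.
  set (D := tail_const * decay (1 / 2) (S N)).
  assert (HD : 0 < D) by (apply Rmult_lt_0_compat; [exact Htc | apply decay_pos]).
  replace (tail_const * B * decay (1 / 2) (S N)) with (D * C / (d / 2)) by (unfold D, B; field; lra).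
  apply (improper_bound (fun v => twisted_eta rho v * damp phi v + -1 * (eta_partial rho N v * damp phi v))
    (D * C) (d / 2)).
  - lra.
  - intros v; apply (continuous_plus (V := R_NormedModule)); [apply continuous_twisted_damp|].
    apply (continuous_scal_r (K := R_AbsRing) (V := R_NormedModule)).
    apply (continuous_mult (K := R_AbsRing)); [apply continuous_eta_partial | apply continuous_damp].
  - intros v Hv.
    replace (twisted_eta rho v * damp phi v + -1 * (eta_partial rho N v * damp phi v))
      with ((twisted_eta rho v - eta_partial rho N v) * damp phi v) by ring.
    assert (Hdb := damp_bound phi v Hv).
    rewrite Rabs_mult, (Rabs_pos_eq (damp _ _)) by lra.
    apply Rle_trans with (D * ((1 / 2 + 1 * v) * damp phi v)).
    + rewrite <- Rmult_assoc; apply Rmult_le_compat_r; [lra|].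
      assert (H := eta_partial_approx rho v N); rewrite (Rabs_pos_eq v) in H by lra; unfold D; lra.
    + rewrite Rmult_assoc; apply Rmult_le_compat_l; [lra|].
      apply linear_damp_bound; lra.
  - unfold Rminus.
    replace (- (/ 2 * kernel phi (ln rho) + / 2 * sum_n (kernel_term rho phi) N))
      with (-1 * (/ 2 * kernel phi (ln rho) + / 2 * sum_n (kernel_term rho phi) N)) by ring.
    apply improper_plus.
    + intros v; apply continuous_twisted_damp.
    + intros v; apply (continuous_scal_r (K := R_AbsRing) (V := R_NormedModule)).
      apply (continuous_mult (K := R_AbsRing)); [apply continuous_eta_partial | apply continuous_damp].
    + apply improper_twisted, Hphi.
    + apply improper_scal; [|apply improper_eta_partial, Hphi].
      intros v; apply (continuous_mult (K := R_AbsRing)); [apply continuous_eta_partial | apply continuous_damp]. }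
assert (HB : 0 < B).
{ unfold B, C; apply Rdiv_lt_0_compat; [|lra].
  assert (0 < 4 * 1 / d) by (apply Rdiv_lt_0_compat; lra); lra. }
set (E := 2 * (tail_const * B)).
assert (HE : 0 < E) by (unfold E; assert (0 < tail_const * B) by (apply Rmult_lt_0_compat; lra); lra).
apply is_series_Rlim, is_lim_seq_eps; intros eps Heps.
destruct (is_lim_seq_eps_inv _ _ (is_lim_seq_decay (1 / 2) ltac:(lra)) (eps / E)) as [N HN].
{ apply Rdiv_lt_0_compat; lra. }
exists N; intros n Hn; specialize (HN (S n) ltac:(lia)); specialize (Happ n).
rewrite Rminus_0_r, Rabs_pos_eq in HN by (left; apply decay_pos).
apply Rlt_div_r in HN; [|exact HE].
apply Rabs_le_between in Happ; apply Rabs_le; unfold E in HN; lra.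
Qed.

(** * Passage to the limit as [phi] tends to [PI] *)

Definition kernel_const : R := 3 * (2 + damp_const).

(** The kernel divided by [kernel_const] takes the place of the wave in [alt_term], with Lipschitz
    constant 1, so the telescoping majorant applies again and does not involve [e]. The condition on
    [n] puts the arguments at distance at least 1 from 0. *)
Lemma kernel_term_le (rho e : R) (n : nat) :
  0 < e <= 1 -> ln rho + 1 <= log_nat n ->
  Rabs (kernel_term rho (PI - e) n)
  <= kernel_const * ((1 / 2 + 1) * (exp (1 / 2) / (1 / 2)) * (decay (1 / 2) n - decay (1 / 2) (S n))).
Proof.
intros He Hn.
assert (HB := damp_const_pos).
assert (HK : 0 < kernel_const) by (unfold kernel_const; lra).
(* Capping the argument makes the Lipschitz bound global, as [alt_term_bound] requires. *)
set (w := fun x => ln rho - Rmax x (ln rho + 1)).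
assert (Hw : forall x, 1 <= Rabs (w x)).
{ intros x; unfold w; assert (H := Rmax_r x (ln rho + 1)).
  rewrite <- Rabs_Ropp, Rabs_pos_eq; lra. }
set (k := fun x => kernel (PI - e) (w x) / kernel_const).
assert (Hk : bounded_lipschitz k 1).
{ split.
  - intros x; unfold k, Rdiv; rewrite Rabs_mult, (Rabs_pos_eq (/ _)) by (left; apply Rinv_0_lt_compat, HK).
    apply Rle_div_l; [exact HK|].
    assert (Hw0 : w x <> 0) by (intros E; specialize (Hw x); rewrite E, Rabs_R0 in Hw; lra).
    eapply Rle_trans; [apply kernel_le; [exact Hw0 | exact He]|].
    assert (H1 : / w x ^ 2 <= 1).
    { rewrite <- Rinv_1; apply Rinv_le_contravar; [lra|].
      rewrite <- (pow2_abs (w x)); specialize (Hw x); nra. }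
    assert (H2 : 0 < / w x ^ 2) by (apply Rinv_0_lt_compat; assert (H := pow2_gt_0 _ Hw0); lra).
    unfold kernel_const.
    assert (0 <= e * (2 + damp_const) <= 2 + damp_const) by nra.
    nra.
  - intros x y; unfold k.
    replace (kernel (PI - e) (w x) / kernel_const - kernel (PI - e) (w y) / kernel_const)
      with ((kernel (PI - e) (w x) - kernel (PI - e) (w y)) / kernel_const) by (field; lra).
    unfold Rdiv; rewrite Rabs_mult, (Rabs_pos_eq (/ _)) by (left; apply Rinv_0_lt_compat, HK).
    apply Rle_div_l; [exact HK|].
    eapply Rle_trans; [apply kernel_lipschitz; [apply Hw | apply Hw | exact He]|].
    fold kernel_const; rewrite Rmult_1_l, Rmult_comm; apply Rmult_le_compat_r; [lra|].
    unfold w, Rmax; destruct (Rle_dec x (ln rho + 1)), (Rle_dec y (ln rho + 1));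
      unfold Rabs; repeat destruct Rcase_abs; lra. }
assert (Hkn : forall j, (n <= j)%nat -> kernel (PI - e) (ln rho - log_nat j) = kernel_const * k (log_nat j)).
{ intros j Hj; unfold k, w; rewrite Rmax_left.
  - field; lra.
  - induction Hj as [|j Hj IH]; [exact Hn|]; assert (H := log_nat_step j); lra. }
replace (kernel_term rho (PI - e) n) with (kernel_const * alt_term k (1 / 2) n).
2:{ unfold kernel_term, alt_term, dir_term; rewrite !Hkn by lia; ring. }
rewrite Rabs_mult, (Rabs_pos_eq kernel_const) by lra.
apply Rmult_le_compat_l; [lra|].
apply alt_term_bound; [exact Hk | lra].
Qed.

Lemma at_left_PI (P : R -> Prop) :
  (forall e, 0 < e <= 1 -> P (PI - e)) -> at_left PI P.
Proof.
intros H; exists (mkposreal 1 Rlt_0_1); intros y Hy Hlt.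
change (Rabs (y - PI) < 1) in Hy; apply Rabs_def2 in Hy.
replace y with (PI - (PI - y)) by ring; apply H; lra.
Qed.

Lemma filterlim_kernel (u : R) :
  u <> 0 -> filterlim (fun phi => kernel phi u) (at_left PI) (locally 0).
Proof.
intros Hu; apply filterlim_locally; intros eps.
assert (HB := damp_const_pos).
set (C := / u ^ 2 * (2 + damp_const)).
assert (HC : 0 < C).
{ apply Rmult_lt_0_compat; [|lra]; apply Rinv_0_lt_compat; assert (H := pow2_gt_0 u Hu); lra. }
assert (He := cond_pos eps).
assert (Hq : 0 < eps / C) by (apply Rdiv_lt_0_compat; lra).
exists (mkposreal (Rmin 1 (eps / C)) (Rmin_pos _ _ Rlt_0_1 Hq)); intros y Hy Hlt.
change (Rabs (y - PI) < Rmin 1 (eps / C)) in Hy; change (Rabs (kernel y u - 0) < eps).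
assert (Hm1 := Rmin_l 1 (eps / C)); assert (Hm2 := Rmin_r 1 (eps / C)).
apply Rabs_def2 in Hy; rewrite Rminus_0_r.
replace y with (PI - (PI - y)) by ring.
eapply Rle_lt_trans; [apply kernel_le; [exact Hu | lra]|].
replace (/ u ^ 2 * ((PI - y) * (2 + damp_const))) with ((PI - y) * C) by (unfold C; ring).
apply Rlt_div_r; [exact HC | lra].
Qed.

Lemma log_nat_unbounded (x : R) : exists N, forall n, (N <= n)%nat -> x <= log_nat n.
Proof.
assert (H := is_lim_seq_log_nat); apply is_lim_seq_spec in H; destruct (H x) as [N HN].
exists N; intros n Hn; left; apply HN, Hn.
Qed.

(** The hypothesis keeps every kernel argument away from 0, including [ln rho] itself at n = 0.
    Tannery's theorem treats the sum of the kernel series, 2 J - kernel, and J is recovered by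
    adding the kernel back. *)
Lemma filterlim_twisted_integral (rho : R) :
  (forall n, ln rho <> log_nat n) ->
  filterlim (twisted_integral rho) (at_left PI) (locally 0).
Proof.
intros Hrho; assert (HPI := PI_gt_3).
assert (Hker : forall n, filterlim (fun phi => kernel phi (ln rho - log_nat n)) (at_left PI) (locally 0)).
{ intros n; apply filterlim_kernel; specialize (Hrho n); lra. }
assert (HS : filterlim (fun phi => 2 * twisted_integral rho phi - kernel phi (ln rho)) (at_left PI) (locally 0)).
{ destruct (log_nat_unbounded (ln rho + 1)) as [N0 HN0].
  apply (tannery_0 (kernel_term rho) (fun n => kernel_const * ((1 / 2 + 1) * (exp (1 / 2) / (1 / 2)) *
     (decay (1 / 2) n - decay (1 / 2) (S n)))) _ N0).
  - intros n; unfold kernel_term; apply filterlim_plus_0; apply filterlim_scal_0, Hker.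
  - apply at_left_PI; intros e He n Hn; apply kernel_term_le; [exact He | apply HN0, Hn].
  - apply (ex_series_scal (V := R_NormedModule)), ex_series_decay_bound; lra.
  - apply at_left_PI; intros e He; apply is_series_kernel_term; rewrite Rabs_pos_eq; lra. }
assert (H0 : filterlim (fun phi => kernel phi (ln rho)) (at_left PI) (locally 0)).
{ apply filterlim_kernel; specialize (Hrho 0%nat); rewrite log_nat_0 in Hrho; exact Hrho. }
apply filterlim_ext with (fun phi => / 2 * (2 * twisted_integral rho phi - kernel phi (ln rho))
  + / 2 * kernel phi (ln rho)).
- intros phi; field.
- apply filterlim_plus_0; apply filterlim_scal_0; assumption.
Qed.

(** * The damped integral and its iterated limit *)

Lemma exp_half_ln_2 : 2 * exp (- (1 / 2) * ln 2) = sqrt 2.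
Proof.
rewrite <- Rpower_sqrt by lra; unfold Rpower.
rewrite <- (exp_ln 2) at 1 by lra; rewrite <- exp_plus; f_equal; field.
Qed.

(** By [eta_eq], the two twisted functions are combinations of z = zeta (1/2 + iv) rotated by v ln r
    and by v ln r shifted by - v ln 2 or + v ln 2. The two shifted rotations add up to 2 cos (v ln
    2) times the unshifted one, with weight - sqrt 2; the unshifted ones have total weight 1 + (sqrt
    2)^2 = 3. *)
Lemma damped_integrand_eq (zeta : C -> C) (r phi v : R) :
  is_riemann_zeta zeta -> 0 < r -> 0 < v ->
  twisted_eta r v * damp phi v + - sqrt 2 * (twisted_eta (2 * r) v * damp phi v)
  = damped_integrand zeta r phi v.
Proof.
intros Hz Hr Hv; unfold damped_integrand, twisted_eta; fold (damp phi v).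
rewrite !(eta_eq zeta) by (exact Hz || lra).
replace (RtoC (1 / 2) + Ci * RtoC v)%C with (((1 / 2)%R, v) : C)
  by (unfold Cplus, Cmult, Ci, RtoC; simpl; f_equal; ring).
replace (Re (Rcpow r (Ci * RtoC v) * zeta ((1 / 2)%R, v))%C) with (Re_rot (v * ln r) (zeta (1 / 2, v))).
2:{ unfold Re_rot, Rcpow, Cexp, Cmult, Ci, RtoC, Re, Im; simpl.
    replace ((0 * v - 1 * 0) * ln r - (0 * 0 + 1 * v) * 0) with 0 by ring.
    replace ((0 * v - 1 * 0) * 0 + (0 * 0 + 1 * v) * ln r) with (v * ln r) by ring.
    rewrite exp_0; ring. }
rewrite ln_mult by lra.
rewrite <- !Rmult_assoc, exp_half_ln_2.
replace (v * (ln 2 + ln r) - v * ln 2) with (v * ln r) by ring.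
set (z := zeta (1 / 2, v)).
assert (Hs : sqrt 2 * sqrt 2 = 2) by (apply sqrt_sqrt; lra).
replace (v * (ln 2 + ln r)) with (v * ln r + v * ln 2) by ring.
unfold Re_rot; rewrite cos_plus, sin_plus, cos_minus, sin_minus.
set (a := cos (v * ln r)); set (b := sin (v * ln r)).
set (c := cos (v * ln 2)); set (s := sin (v * ln 2)).
replace 3 with (1 + sqrt 2 * sqrt 2) by (rewrite Hs; ring).
ring.
Qed.

Lemma is_RInt_gen_damped (zeta : C -> C) (r phi : R) :
  is_riemann_zeta zeta -> 0 < r -> Rabs phi < PI ->
  is_RInt_gen (damped_integrand zeta r phi) (at_point 0) (Rbar_locally p_infty)
    (twisted_integral r phi + - sqrt 2 * twisted_integral (2 * r) phi).
Proof.
intros Hz Hr Hphi.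
apply (improper_is_RInt_gen
  (fun v => twisted_eta r v * damp phi v + - sqrt 2 * (twisted_eta (2 * r) v * damp phi v))).
- intros v; apply (continuous_plus (V := R_NormedModule)); [apply continuous_twisted_damp|].
  apply (continuous_scal_r (K := R_AbsRing) (V := R_NormedModule)), continuous_twisted_damp.
- intros v Hv; apply damped_integrand_eq; assumption.
- apply improper_plus.
  + intros v; apply continuous_twisted_damp.
  + intros v; apply (continuous_scal_r (K := R_AbsRing) (V := R_NormedModule)), continuous_twisted_damp.
  + apply improper_twisted, Hphi.
  + apply improper_scal; [intros v; apply continuous_twisted_damp | apply improper_twisted, Hphi].
Qed.

Lemma ln_neq_log_nat (x : R) (n : nat) : 0 < x -> x <> INR (S n) -> ln x <> log_nat n.
Proof.
intros Hx Hn E; apply Hn, ln_inv; [exact Hx | apply lt_0_INR; lia | exact E].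
Qed.

Lemma INR_between_neq (m n : nat) (x : R) : INR m < x < INR (S m) -> x <> INR n.
Proof.
intros [H1 H2] ->; apply INR_lt in H1; apply INR_lt in H2; lia.
Qed.

Theorem mainTheorem16 (zeta : C -> C) (hzeta : is_riemann_zeta zeta) :
  (forall r phi : R, 0 < r -> Rabs phi < PI -> damped_integral_converges zeta r phi) /\
  (exists L : R -> R,
     locally' 1 (fun r : R =>
       filterlim (fun phi : R => damped_integral zeta r phi) (at_left PI) (locally (L r))) /\
     filterlim L (locally' 1) (locally 0)).
Proof.
split.
- intros r phi Hr Hphi; eexists; apply is_RInt_gen_damped; eassumption.
(* The inner limit is already 0 for each [r] near 1 and distinct from 1, so the outer limit is that
   of a constant. *)
- exists (fun _ => 0); split; [|apply filterlim_const].
  (* Radius 1/2 puts [r] in (1/2, 3/2) and 2 r in (1, 3); the only positive integers there are 1 and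
     2 respectively, both attained only at r = 1. *)
  exists (mkposreal (1 / 2) ltac:(lra)); intros r Hr Hr1.
  change (Rabs (r - 1) < 1 / 2) in Hr; apply Rabs_def2 in Hr.
  assert (HPI := PI_gt_3).
  (* Near [PI] on the left one has |phi| < [PI], and there the value of [RInt_gen] is given by the
     convergent integrals. *)
  apply filterlim_ext_loc with
    (fun phi => twisted_integral r phi + - sqrt 2 * twisted_integral (2 * r) phi).
  + apply at_left_PI; intros e He; symmetry.
    apply (is_RInt_gen_unique (V := R_CompleteNormedModule)), is_RInt_gen_damped;
      [exact hzeta | lra | rewrite Rabs_pos_eq; lra].
  + apply filterlim_plus_0; [|apply filterlim_scal_0]; apply filterlim_twisted_integral;
      intros n; (apply ln_neq_log_nat; [lra|]).
    * destruct (Rlt_le_dec r 1) as [H|H];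
        [apply (INR_between_neq 0) | apply (INR_between_neq 1)]; simpl; lra.
    * destruct (Rlt_le_dec r 1) as [H|H];
        [apply (INR_between_neq 1) | apply (INR_between_neq 2)]; simpl; lra.
Qed.
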